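(* Let $K$ be a compact Lie group, let $n>2$, let $F_n$ be the free group on $n$ generators, and let $a_1,a_2,\ldots,a_n$ be a basis of $F_n$. Let $X$ be the set of those $\rho\in\mathrm{Hom}(F_n,K)$ for which $\lambda_1<2n$, where $\lambda_1=\lambda_1(\rho)$ is the supremum of the eigenvalues of the operator $\rho(a_1)+\rho(a_1)^{-1}+\cdots+\rho(a_n)+\rho(a_n)^{-1}$ on $L^2_0(K)$. If the action of $\mathrm{Out}(F_n)$ on $\mathrm{Hom}(F_n,K)/K$ is ergodic, then the measure of $X$ is either $0$ or $1$.
   Context: $L^2_0(K)$ is the orthogonal complement of the constant functions in $L^2(K)$ (Haar measure), on which $K$ acts unitarily through left translation, $(kf)(x)=f(k^{-1}x)$; sums of group elements denote sums of the corresponding unitary operators. $\mathrm{Hom}(F_n,K)$ is identified with $K^n$ via $\rho\mapsto(\rho(a_1),\ldots,\rho(a_n))$ and carries the product of normalized Haar measures. $K$ acts on $\mathrm{Hom}(F_n,K)$ by conjugation, and the quotient $\mathrm{Hom}(F_n,K)/K$ carries the pushforward measure. $\mathrm{Aut}(F_n)$ acts on $\mathrm{Hom}(F_n,K)$ by precomposition, preserving the measure, and this descends to a measure-preserving action of the outer automorphism group $\mathrm{Out}(F_n)$ on $\mathrm{Hom}(F_n,K)/K$. *)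

(* Defs.v *)
From HB Require Import structures.
From mathcomp Require Import all_boot all_order all_algebra.
From mathcomp Require Import complex.
From mathcomp Require Import all_classical all_reals all_analysis.

Set Implicit Arguments.
Unset Strict Implicit.
Unset Printing Implicit Defensive.

Import Order.TTheory GRing.Theory Num.Theory.
Import numFieldNormedType.Exports.

Local Open Scope classical_set_scope.
Local Open Scope quotient_scope.
Local Open Scope ring_scope.

(* Pointed only because the library's measurable types are; the distinguished
   point plays no role.  Continuity of the group operations is part of
   is_lie_group below. *)
#[short(type="ptopGroupType")]
HB.structure Definition PTopGroup := {K of Group K & PointedTopological K}.

(* On an open subset U of a finite-dimensional space, having continuous iterated
   directional derivatives up to order k is being of class C^k. *)
Fixpoint class_C (R : realType) (V W : normedModType R) (k : nat) (U : set V)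
    (f : V -> W) : Prop :=
  (forall x, U x -> {for x, continuous f}) /\
  if k is k'.+1 then
    forall v : V, (forall x, U x -> derivable f x v) /\ class_C k' U ('D_v f)
  else True.

Definition smooth (R : realType) (V W : normedModType R) (U : set V)
    (f : V -> W) : Prop :=
  forall k, class_C k U f.

(* Total maps stand for the partial ones: only the values of chart_map on
   chart_dom and of chart_inv on chart_cod matter. *)
Record chart (R : realType) (T : Type) (d : nat) := Chart {
  chart_dom : set T;
  chart_map : T -> 'rV[R]_d;
  chart_inv : 'rV[R]_d -> T }.

Definition chart_cod (R : realType) (T : Type) (d : nat) (c : chart R T d) :
  set 'rV[R]_d := chart_map c @` chart_dom c.

Definition is_chart (R : realType) (T : topologicalType) (d : nat)
    (c : chart R T d) : Prop :=
  [/\ open (chart_dom c), open (chart_cod c),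
      forall x, chart_dom c x -> {for x, continuous (chart_map c)},
      forall y, chart_cod c y -> {for y, continuous (chart_inv c)} &
      forall x, chart_dom c x -> chart_inv c (chart_map c x) = x].

Definition smooth_atlas (R : realType) (T : topologicalType) (d : nat)
    (A : set (chart R T d)) : Prop :=
  [/\ forall c, A c -> is_chart c,
      forall x, exists2 c, A c & chart_dom c x &
      forall c1 c2, A c1 -> A c2 ->
        smooth (chart_map c1 @` (chart_dom c1 `&` chart_dom c2))
               (chart_map c2 \o chart_inv c1)].

Definition is_lie_group (R : realType) (K : ptopGroupType) : Prop :=
  [/\ hausdorff_space K, @second_countable K,
      continuous (fun x : K * K => (x.1 * x.2)%g),
      continuous (fun x : K => x^-1%g) &
      exists (d : nat) (A : set (chart R K d)),
        [/\ smooth_atlas A,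
            forall c1 c2 c3, A c1 -> A c2 -> A c3 ->
              smooth [set y : 'rV[R]_d * 'rV[R]_d |
                        [/\ chart_cod c1 y.1, chart_cod c2 y.2 &
                            chart_dom c3
                              (chart_inv c1 y.1 * chart_inv c2 y.2)%g]]
                (fun y =>
                   chart_map c3 (chart_inv c1 y.1 * chart_inv c2 y.2)%g) &
            forall c1 c2, A c1 -> A c2 ->
              smooth [set y : 'rV[R]_d |
                        chart_cod c1 y /\ chart_dom c2 (chart_inv c1 y)^-1%g]
                (fun y => chart_map c2 (chart_inv c1 y)^-1%g)]].

Definition is_compact_lie_group (R : realType) (K : ptopGroupType) : Prop :=
  is_lie_group R K /\ compact [set: K].

Definition borel (K : ptopGroupType) := g_sigma_algebraType (@open K).

(* On a second countable compact group every Borel probability measure is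
   regular, so left invariance determines the normalized Haar measure. *)
Definition is_haar (R : realType) (K : ptopGroupType)
    (mu : probability (borel K) R) : Prop :=
  forall (k : K) (A : set (borel K)), measurable A ->
    mu [set (k * x)%g | x in (A : set K)] = mu A.

Section power_probability.
Context d (T : measurableType d) (R : realType) (P : probability T R).

Definition tuple_cons (n : nat) (x : T * n.-tuple T) : n.+1.-tuple T :=
  [tuple of x.1 :: x.2].

Lemma measurable_tuple_cons n : measurable_fun setT (@tuple_cons n).
Proof. exact: measurable_cons. Qed.

HB.instance Definition _ n := isMeasurableFun.Build _ _ _ _ (@tuple_cons n)
  (@measurable_tuple_cons n).

Fixpoint power_probability (n : nat) : probability (n.-tuple T) R :=
  match n with
  | 0 => dirac [tuple]
  | m.+1 => distribution (P \x power_probability m)%E (@tuple_cons m)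
  end.

End power_probability.

Lemma power_probability_box d (T : measurableType d) (R : realType)
    (P : probability T R) (n : nat) (A : 'I_n -> set T) :
  (forall i, measurable (A i)) ->
  power_probability P n [set t | forall i, A i (tnth t i)] =
  (\prod_(i < n) P (A i))%E.
Proof.
elim: n => [|n IHn] in A *; move=> mA.
  rewrite big_ord0 /= diracE mem_set//= => -[].
  by [].
rewrite big_ord_recl -IHn; last by move=> i; exact: mA.
rewrite /= /distribution /pushforward.
rewrite (_ : _ @^-1` _ =
  A ord0 `*` [set t | forall i, A (lift ord0 i) (tnth t i)]).
  rewrite product_measure1E//=.
  rewrite (_ : mkset _ = \bigcap_(i in [set: 'I_n])
    (fun t : n.-tuple T => tnth t i) @^-1` A (lift ord0 i)); last first.
    by apply/seteqP; split => t /= h i; [move=> _|]; exact: h.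
  apply: fin_bigcap_measurable => // i _.
  rewrite -[X in measurable X]setTI; apply: measurable_tnth => //.
apply/seteqP; split => -[x t] /=.
- move=> h; split; first by have := h ord0; rewrite tnth0.
  by move=> i; have := h (lift ord0 i); rewrite tnthS.
- move=> [h0 h] i; have [j ->|->] := unliftP ord0 i; first by rewrite tnthS.
  by rewrite tnth0.
Qed.

Section L2.
Context (R : realType) (K : ptopGroupType) (mu : probability (borel K) R).

(* Elements of L^2(K) are represented by functions, equality being equality
   mu-almost everywhere. *)
Definition L2 : set (K -> R[i]) :=
  [set f | (fun x : borel K => complex.Re (f x)) \in Lfun mu 2%:E /\
           (fun x : borel K => complex.Im (f x)) \in Lfun mu 2%:E].

Definition L2_dot (f g : K -> R[i]) : R[i] :=
  Complex (\int[mu]_x complex.Re (f x * (g x)^*))%R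
          (\int[mu]_x complex.Im (f x * (g x)^*))%R.

Definition L2_0 : set (K -> R[i]) :=
  [set f | L2 f /\ forall c : R[i], L2_dot f (cst c) = 0].

Definition ltranslate (k : K) (f : K -> R[i]) : K -> R[i] :=
  fun x => f (k^-1 * x)%g.

Definition L2_0_eigenvalue (T : (K -> R[i]) -> (K -> R[i])) (l : R[i]) : Prop :=
  exists f : K -> R[i],
    [/\ L2_0 f, ~ {ae mu, forall x, f x = 0} &
        {ae mu, forall x, T f x = l * f x}].

End L2.

Definition GrpHom (G H : groupType) := UMagmaMorphism.type G H.
HB.instance Definition _ (G H : groupType) := gen_eqMixin (GrpHom G H).
HB.instance Definition _ (G H : groupType) := gen_choiceMixin (GrpHom G H).

Definition hom_comp (G H L : groupType) (rho : GrpHom H L) (phi : GrpHom G H) :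
  GrpHom G L := rho \o phi.

Definition is_free_basis (F : groupType) (n : nat) (a : 'I_n -> F) : Prop :=
  forall (G : groupType) (g : 'I_n -> G),
    exists! f : GrpHom F G, forall i, f (a i) = g i.

Lemma grphomP (G H : groupType) (rho sigma : GrpHom G H) :
  rho =1 sigma -> rho = sigma.
Proof.
case: rho sigma => [f [[fM] [f1]]] [g [[gM] [g1]]] /= /funext fg.
by subst g; rewrite (Prop_irrelevance fM gM) (Prop_irrelevance f1 g1).
Qed.

Definition conj_rel (G H : groupType) : rel (GrpHom G H) := fun rho sigma =>
  `[< exists k : H, forall x, sigma x = (k * rho x * k^-1)%g >].

Lemma conj_rel_equiv (G H : groupType) : equiv_class_of (@conj_rel G H).
Proof.
split.
- by move=> rho; apply/asboolP; exists 1%g => x; rewrite mul1g invg1 mulg1.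
- move=> rho sigma; apply/asboolP/asboolP => -[k E]; exists k^-1%g => x;
    by rewrite E invgK !mulgA mulVg mul1g mulgVK.
- move=> sigma rho tau /asboolP[k E] /asboolP[l E'].
  by apply/asboolP; exists (l * k)%g => x; rewrite E' E invgM !mulgA.
Qed.

Canonical conj_equiv (G H : groupType) := EquivRelPack (@conj_rel_equiv G H).

Definition GrpHomQ (G H : groupType) := {eq_quot @conj_equiv G H}.

Record GrpAut (F : groupType) := MkGrpAut {
  aut_hom :> GrpHom F F;
  aut_bij : bijective aut_hom }.
HB.instance Definition _ (F : groupType) := gen_eqMixin (GrpAut F).
HB.instance Definition _ (F : groupType) := gen_choiceMixin (GrpAut F).

(* conj_rel phi psi on automorphisms: psi = i \o phi for some inner i *)
Definition inn_rel (F : groupType) : rel (GrpAut F) :=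
  fun phi psi => conj_rel (phi : GrpHom F F) (psi : GrpHom F F).

Lemma inn_rel_equiv (F : groupType) : equiv_class_of (@inn_rel F).
Proof.
have [r s t] := @conj_rel_equiv F F.
by split=> [phi|phi psi|psi phi chi]; [exact: r|exact: s|exact: t].
Qed.

Canonical inn_equiv (F : groupType) := EquivRelPack (@inn_rel_equiv F).

Definition GrpOut (F : groupType) := {eq_quot @inn_equiv F}.

(* Precomposition on representatives; see out_actE for independence of the
   choice. This is a right action; the associated left action, by inverses, has
   the same invariant sets. *)
Definition out_act (F K : groupType) (o : GrpOut F) (c : GrpHomQ F K) :
  GrpHomQ F K :=
  \pi_(GrpHomQ F K) (hom_comp (repr c) (aut_hom (repr o))).

Lemma out_actE (F K : groupType) (phi : GrpAut F) (rho : GrpHom F K) :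
  out_act (\pi_(GrpOut F) phi) (\pi_(GrpHomQ F K) rho) =
  \pi_(GrpHomQ F K) (hom_comp rho phi).
Proof.
rewrite /out_act.
have /eqmodP/asboolP[g Eg] : repr (\pi_(GrpOut F) phi) = phi %[mod GrpOut F].
  by rewrite reprK.
have /eqmodP/asboolP[k Ek] :
    repr (\pi_(GrpHomQ F K) rho) = rho %[mod GrpHomQ F K].
  by rewrite reprK.
apply/eqmodP/asboolP; exists (rho g * k)%g => x /=.
rewrite Eg !gmulfM !gmulfV !Ek !invgM !mulgA.
by rewrite !(mulgVK, mulgK).
Qed.

Section hom_measure.
Context (R : realType) (K : ptopGroupType) (mu : probability (borel K) R).
Context (F : groupType) (n : nat) (a : 'I_n -> F).

(* The identification of Hom(F, K) with K^n, when a is a free basis of F; the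
   measurable sets and the measure are transported along it. *)
Definition hom_eval (rho : GrpHom F K) : n.-tuple (borel K) :=
  [tuple (rho (a i) : borel K) | i < n].

Definition hom_measurable : set (set (GrpHom F K)) :=
  [set A | measurable (hom_eval @` A)].

Definition hom_measure (A : set (GrpHom F K)) : \bar R :=
  power_probability mu n (hom_eval @` A).

Definition homQ_measurable : set (set (GrpHomQ F K)) :=
  [set B | hom_measurable (\pi_(GrpHomQ F K) @^-1` B)].

Definition homQ_measure (B : set (GrpHomQ F K)) : \bar R :=
  hom_measure (\pi_(GrpHomQ F K) @^-1` B).

Definition basis_operator (rho : GrpHom F K) (f : K -> R[i]) : K -> R[i] :=
  fun x => \sum_(i < n) (ltranslate (rho (a i)) f x +
                         ltranslate (rho (a i))^-1%g f x).

(* The operator is self-adjoint, so its eigenvalues are real. *)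
Definition lambda1 (rho : GrpHom F K) : \bar R :=
  ereal_sup [set l%:E | l in
    [set l : R | L2_0_eigenvalue mu (basis_operator rho) (Complex l 0)]].

End hom_measure.

Definition is_ergodic (R : realType) (I T : Type) (M : set (set T))
    (nu : set T -> \bar R) (act : I -> T -> T) : Prop :=
  forall B : set T, M B -> (forall i, act i @^-1` B = B) ->
    nu B = 0%E \/ nu B = 1%E.

(* Main.v *)
(* The condition lambda_1(rho) < 2n is equivalent to a spectral gap: there is
   e > 0 with  e |f|^2 <= \sum_i |rho(a_i) f - f|^2  for all continuous f of
   mean 0.  The right hand side is 2n |f|^2 - <T f, f>, so a gap bounds the
   eigenvalues of T away from 2n.  Conversely, T commutes with the right
   convolution operators A, which are compact (Arzela-Ascoli) and, when the
   kernel is symmetric, self-adjoint.  If <T f, f> > c |f|^2, then A f has the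
   same property for a suitable approximate identity, so S = (T - c) A^2 has a
   positive eigenvalue b.  The space ker(S - b) is T-invariant with a compact
   unit ball, hence contains an eigenvector of T; its eigenvalue t satisfies
   b |f|^2 = (t - c) |A f|^2, whence t > c.

   The displacement |rho(w) f - f|^2 is at most C_w \sum_i |rho(a_i) f - f|^2,
   since the a_i generate F; so the gap does not depend on the basis and is
   invariant under Aut(F), and it is invariant under conjugation because
   translations are isometries.  Finally, k |-> |k f - f|^2 being continuous,
   the set of n-tuples with a gap is a countable union of closed sets.  Hence X
   descends to an Out(F)-invariant measurable set, and ergodicity applies. *)
Require Import Defs.
From HB Require Import structures.
From mathcomp Require Import all_boot all_order all_algebra.
From mathcomp Require Import all_classical all_reals all_analysis.
From mathcomp Require Import measurable_realfun complex lra ring.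

Set Implicit Arguments.
Unset Strict Implicit.
Unset Printing Implicit Defensive.

Import Order.TTheory GRing.Theory Num.Theory.
Import numFieldNormedType.Exports.

Local Open Scope classical_set_scope.
Local Open Scope ring_scope.

(** * Measurability on second countable compact spaces *)

Section TopologicalMeasure.
Context (R : realType) (K : ptopGroupType) (mu : probability (borel K) R).

Lemma open_borel_measurable (U : set K) :
  open U -> measurable (U : set (borel K)).
Proof. exact: sub_sigma_algebra. Qed.

Lemma lower_measurable_fun d (T : measurableType d) (f : T -> R) :
  (forall c, measurable [set x | c < f x]) -> measurable_fun setT f.
Proof.
move=> mf; apply: (measurability (@RGenOInfty.G R)).
  exact: RGenOInfty.measurableE.
move=> _ [_ [c ->] <-]; rewrite setTI.
rewrite (_ : _ @^-1` _ = [set x | c < f x])//.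
by apply/seteqP; split => x; rewrite /= in_itv/= andbT.
Qed.

Lemma open_gt_preimage (T : topologicalType) (f : T -> R) c :
  continuous f -> open [set x | c < f x].
Proof.
move=> /continuousP cf.
rewrite (_ : [set _ | _] = f @^-1` [set y | c < y]) //; exact/cf/open_gt.
Qed.

Lemma continuous_borel_measurable (f : K -> R) :
  continuous f -> measurable_fun setT (f : borel K -> R).
Proof.
move=> cf; apply: lower_measurable_fun => c.
exact: (open_borel_measurable (@open_gt_preimage K f c cf)).
Qed.

Lemma continuous_borel_endo (f : K -> K) :
  continuous f -> measurable_fun setT (f : borel K -> borel K).
Proof.
move=> /continuousP cf.
apply: (@measurability _ _ (borel K) (borel K) setT f (@open K)) => //.
by move=> _ [U oU <-]; rewrite setTI; apply: open_borel_measurable; exact: cf.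
Qed.

Lemma second_countable_seq : @second_countable K ->
  exists b : nat -> set K, (forall i, open (b i)) /\
    forall (x : K) (U : set K), nbhs x U -> exists2 i, b i x & b i `<=` U.
Proof.
move=> [B cB [Bo Bn]].
have [B0|[b]] := pfcard_geP cB.
  (* A base is never empty: some member of it lies inside the neighbourhood [setT] of [point]. *)
  by have [V [+ _] _] := Bn point _ (filterT : nbhs point setT); rewrite B0.
exists b; split=> [i|x U /Bn[V [BV Vx] VU]]; first exact/Bo/funS.
by have [i _ biV] := @surj _ _ _ _ b V BV; exists i; rewrite biV.
Qed.

(** Measurability is for the product sigma-algebra, which contains the open rectangles. Second
    countability makes every open subset of the product a countable union of basic rectangles. *)
Lemma continuous_measurable_prod (h : K * K -> R) : @second_countable K ->
  continuous h -> measurable_fun setT (h : borel K * borel K -> R).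
Proof.
move=> /second_countable_seq[b [ob bP]] ch; apply: lower_measurable_fun => c.
rewrite (_ : mkset _ = \bigcup_(p in [set p : nat * nat |
    b p.1 `*` b p.2 `<=` [set x | c < h x]]) (b p.1 `*` b p.2)).
  rewrite bigcup_mkcond; apply: countable_bigcupT_measurable => // p.
  case: ifPn => // _.
  by apply: measurableX; exact: open_borel_measurable.
apply/seteqP; split=> [[x y] /= cxy|x [p /= pS] /pS//].
have /= : nbhs (x, y) [set x | c < h x].
  by apply: open_nbhs_nbhs; split => //; exact: open_gt_preimage.
move=> -[[U V] /= [/bP[i bix biU] /bP[j bjx bjV]] UV].
exists (i, j) => //= -[u v] [/= ? ?]; apply: UV.
by split; [exact: biU|exact: bjV].
Qed.

(** The hypothesis says that [W] is open for the product topology, phrased with basic boxes. There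
    are only countably many boxes, being indexed by finite functions into [nat]. *)
Lemma measurable_tuple_box n (b : nat -> set K) (W : set (n.-tuple K)) :
  (forall i, open (b i)) ->
  (forall t, W t -> exists f : 'I_n -> nat,
     (forall i, b (f i) (tnth t i)) /\
     forall s : n.-tuple K, (forall i, b (f i) (tnth s i)) -> W s) ->
  measurable (W : set (n.-tuple (borel K))).
Proof.
move=> ob WP.
pose box (f : {ffun 'I_n -> nat}) : set (n.-tuple (borel K)) :=
  [set s | forall i, b (f i) (tnth s i)].
rewrite (_ : W = \bigcup_(f in [set f | box f `<=` W]) box f).
  rewrite bigcup_mkcond; apply: countable_bigcupT_measurable => // f.
  case: ifPn => // _.
  rewrite (_ : box f = \bigcap_(i in [set: 'I_n])
    (fun t : n.-tuple (borel K) => tnth t i) @^-1` b (f i)); last first.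
    by apply/seteqP; split => t /= ht i; [move=> _|]; exact: ht.
  apply: fin_bigcap_measurable => // i _.
  rewrite -[X in measurable X]setTI; apply: measurable_tnth => //.
  exact: open_borel_measurable.
apply/seteqP; split=> [t /WP[f [ft fW]]|t [f /= fW] /fW//].
by exists (finfun f) => [s /= bs|i]; [apply: fW => i|]; rewrite ?ffunE//;
  have := bs i; rewrite ffunE.
Qed.

Hypothesis cK : compact [set: K].

Lemma continuous_bounded (f : K -> R) : continuous f ->
  exists2 M, 0 < M & forall x, `|f x| <= M.
Proof.
move=> cf; have : compact (f @` setT).
  by apply: continuous_compact => //; exact: continuous_subspaceT.
move=> /compact_bounded[M [_ fM]].
exists (`|M| + 1); first by rewrite ltr_wpDl.
by move=> x; apply: fM; [rewrite (le_lt_trans (ler_norm _))// ltrDl|exists x].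
Qed.

Lemma bounded_integrable (f : borel K -> R) M : measurable_fun setT f ->
  (forall x, `|f x| <= M) -> mu.-integrable setT (EFin \o f).
Proof.
move=> mf fM; apply: measurable_bounded_integrable => //.
  by rewrite -ge0_fin_numE ?fin_num_measure.
exists M; split; first exact: num_real.
by move=> y My x _; apply: (le_trans (fM x)); exact: ltW.
Qed.

Lemma continuous_integrable (f : K -> R) : continuous f ->
  mu.-integrable setT (EFin \o (f : borel K -> R)).
Proof.
move=> cf; have [M _ fM] := continuous_bounded cf.
by apply: (bounded_integrable (M := M)) => //; exact: continuous_borel_measurable.
Qed.

(** The tube lemma: compactness of [K] makes one neighbourhood of [x] serve all [y] at once. It
    supplies the uniform continuity of kernels needed below. *)
Lemma continuous_tube (T : topologicalType) (h : T * K -> R) x e : continuous h ->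
  0 < e -> \forall x' \near x, forall y, `|h (x, y) - h (x', y)| < e.
Proof.
move=> ch e0.
have /compact_near_coveringP/(_ _ (nbhs x)
  (fun x' y => `|h (x, y) - h (x', y)| < e)) := cK.
have H : forall y, [set: K] y -> \forall y' \near y & x' \near x,
    `|h (x, y') - h (x', y')| < e.
  move=> y _.
  have e20 : 0 < e / 2 by rewrite divr_gt0.
  have /cvgrPdist_lt/(_ _ e20) := ch (x, y).
  move=> -[[U V] /= [Ux Vy] UV].
  exists (V, U) => //= -[y' x'] [/= Vy' Ux'].
  have h1 := UV (x', y') (conj Ux' Vy').
  have h2 := UV (x, y') (conj (nbhs_singleton Ux) Vy').
  rewrite /= in h1 h2.
  have := ler_distD (h (x, y)) (h (x, y')) (h (x', y')).
  by rewrite [`|h (x, y') - h (x, y)|]distrC; lra.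
by move=> /(_ _ H); apply: filterS => x' P y; exact: P.
Qed.

End TopologicalMeasure.

(** * Haar measure *)

Section HaarIntegral.
Context (R : realType) (K : ptopGroupType) (mu : probability (borel K) R).
Hypothesis cK : compact [set: K].
Hypothesis cmulK : continuous (fun x : K * K => (x.1 * x.2)%g).
Hypothesis haar : is_haar mu.

Lemma continuous_mulgl (k : K) : continuous (fun x : K => (k * x)%g).
Proof.
move=> x; apply: (@continuous_comp _ _ _ (fun x : K => (k, x))
  (fun x : K * K => (x.1 * x.2)%g)); last exact: cmulK.
by apply: cvg_pair; [exact: cvg_cst|exact: cvg_id].
Qed.

Lemma measurable_mulgl (k : K) :
  measurable_fun setT (fun x : borel K => (k * x)%g : borel K).
Proof. exact: (continuous_borel_endo (@continuous_mulgl k)). Qed.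

(** [is_haar] speaks of direct images; the preimage under translation by [k] is the image under
    translation by its inverse. *)
Lemma haar_pushforward (k : K) (A : set (borel K)) : measurable A ->
  pushforward mu (fun x : borel K => (k * x)%g : borel K) A = mu A.
Proof.
move=> mA; rewrite -(haar (k^-1)%g mA) /pushforward; congr (mu _).
apply/seteqP; split=> [x /= Ax|_ [x /= Ax <-]].
  by exists (k * x)%g => //; rewrite mulgA mulVg mul1g.
by rewrite mulgA mulgV mul1g.
Qed.

Lemma integrable_mulgl (k : K) (f : borel K -> R) :
  mu.-integrable setT (EFin \o f) ->
  mu.-integrable setT (EFin \o (fun x : borel K => f (k * x)%g)).
Proof.
move=> /integrableP[mf foo]; apply/integrableP; split.
  by move/measurable_EFinP: mf => mf; apply/measurable_EFinP;
    exact: (measurableT_comp mf (measurable_mulgl k)).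
have mk := measurable_mulgl k.
have := ge0_integral_pushforward mk mu (D := setT)
  (f := fun x => `|(f x)%:E|%E).
rewrite preimage_setT => <- //; last exact: measurableT_comp.
rewrite (eq_measure_integral mu)// => A mA _; exact: haar_pushforward.
Qed.

Lemma haar_integral (k : K) (f : borel K -> R) :
  mu.-integrable setT (EFin \o f) ->
  \int[mu]_x f (k * x)%g = \int[mu]_x f x.
Proof.
move=> fi; have mk := measurable_mulgl k.
have := integral_pushforward mk (D := setT) (f := EFin \o f) _
  (integrable_mulgl k fi).
rewrite preimage_setT /Rintegral => <- //; last by case/integrableP : fi.
congr fine; apply: eq_measure_integral => A mA _; exact: haar_pushforward.
Qed.

(** By compactness finitely many translates of [U] cover [K]; if [U] were null, so would be the
    whole group. *)
Lemma haar_open_gt0 (U : set K) x : open U -> U x ->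
  (0 < mu (U : set (borel K)))%E.
Proof.
move=> oU Ux; rewrite lt0e measure_ge0 andbT; apply/negP => /eqP U0.
pose V (k : K) := (fun y => (k * y)%g) @^-1` U.
have oV k : open (V k).
  by move/continuousP: (@continuous_mulgl k); exact.
have := cK; rewrite compact_cover => /(_ K setT V).
case=> [k _|y _|D _ Dcov]; first exact: oV.
  by exists (x * y^-1)%g => //; rewrite /V /= mulgVK.
have V0 k : mu (V k : set (borel K)) = 0.
  by have := haar_pushforward k (open_borel_measurable oU); rewrite /pushforward U0.
have negV (s : seq K) :
    mu.-negligible (\bigcup_(k in [set` s]) (V k : set (borel K))).
  elim: s => [|k s IHs].
    by rewrite bigcup0 //; exact: negligible_set0.
  have nk : mu.-negligible (V k : set (borel K)).
    by apply/negligibleP; [exact: open_borel_measurable|exact: V0].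
  apply: (negligibleS _ (negligibleU nk IHs)).
  move=> y [l /=]; rewrite inE => /orP[/eqP->|ls] Vy; first by left.
  by right; exists l.
have : mu.-negligible [set: borel K].
  suff -> : [set: borel K] =
    \bigcup_(k in [set` finmap.enum_fset D]) (V k : set (borel K)) by exact: negV.
  by apply/seteqP; split => // y _; exact: Dcov.
move/negligibleP => /(_ measurableT) T0.
by have /eqP := probability_setT mu; rewrite T0 eq_sym onee_eq0.
Qed.

(** The function exceeds half of [f x] on an open neighbourhood of [x], which has positive
    measure. *)
Lemma haar_integral_gt0 (f : K -> R) x : continuous f -> (forall y, 0 <= f y) ->
  0 < f x -> 0 < \int[mu]_x f x.
Proof.
move=> cf f0 fx0; pose U := [set y | f x / 2 < f y].
have oU : open U by exact: open_gt_preimage.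
have Ux : U x by rewrite /U /=; lra.
have mU := open_borel_measurable oU.
have fi := continuous_integrable mu cK cf.
have : ((f x / 2)%:E * mu (U : set (borel K)) <= \int[mu]_y (f y)%:E)%E.
  apply: (@le_trans _ _ (\int[mu]_(y in U) (f y)%:E)%E); last first.
    apply: ge0_subset_integral => //; first by case/integrableP : fi.
    by move=> y _; rewrite lee_fin.
  rewrite -integral_cst//; apply: ge0_le_integral => //=.
  - by move=> y _; rewrite lee_fin divr_ge0 // ltW.
  - by case/integrableP : (integrableS measurableT mU (@subsetT _ _) fi).
  - by move=> y Uy; rewrite lee_fin ltW.
rewrite /Rintegral => h; rewrite fine_gt0 //.
have lty : (\int[mu]_x (f x)%:E < +oo)%E.
  exact: integrable_lty fi.
rewrite lty andbT; apply: lt_le_trans h.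
by rewrite mule_gt0 ?(haar_open_gt0 oU Ux)// lte_fin divr_gt0.
Qed.

End HaarIntegral.

(** * Continuous functions separate integrable ones *)

Section Density.
Context (R : realType) (K : ptopGroupType) (mu : probability (borel K) R).
Hypothesis hK : hausdorff_space K.
Hypothesis cK : compact [set: K].
Hypothesis scK : @second_countable K.

Lemma urysohn_open (F U : set K) : closed F -> open U -> F `<=` U ->
  exists phi : K -> R, [/\ continuous phi, forall x, 0 <= phi x <= 1,
    forall x, F x -> phi x = 1 & forall x, ~ U x -> phi x = 0].
Proof.
move=> cF oU FU.
have /normal_separatorP/(_ (~` U) F) := compact_normal hK cK.
have UF0 : ~` U `&` F = set0.
  by apply/seteqP; split => // x [/= nUx /FU].
move=> /(_ R (open_closedC oU) cF UF0) /(@uniform_separatorP _ R).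
move=> [phi [cphi rphi phi0 phi1]]; exists phi; split => // x.
- by have /= := rphi (phi x) (ex_intro2 _ _ x I erefl); rewrite in_itv.
- by move=> Fx; have := phi1 (phi x); apply; exists x.
- by move=> Ux; have := phi0 (phi x); apply; exists x.
Qed.

Lemma regular_open (U : set K) x : open U -> U x ->
  exists2 V, nbhs x V & closure V `<=` U.
Proof.
move=> oU Ux; have cx := accessible_closed_set1 (hausdorff_accessible hK) (x := x).
have [|V Vx VU] := compact_normal hK cK cx (_ : set_nbhs [set x] U).
  by move=> _ ->; exact: open_nbhs_nbhs.
by exists V => //; exact: Vx.
Qed.

Lemma open_indic_approx (U : set K) : open U ->
  exists h : nat -> K -> R, [/\ forall m, continuous (h m),
    forall m x, 0 <= h m x <= 1,
    forall x, U x -> \forall m \near \oo, h m x = 1 &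
    forall m x, ~ U x -> h m x = 0].
Proof.
move=> oU; have [b [ob bP]] := second_countable_seq scK.
have /choice[g gP] : forall i, exists g : K -> R,
    [/\ continuous g, forall x, 0 <= g x <= 1,
        closure (b i) `<=` U -> forall x, b i x -> g x = 1 &
        forall x, ~ U x -> g x = 0].
  move=> i; have [biU|nbiU] := pselect (closure (b i) `<=` U).
    have [g [? ? g1 ?]] := urysohn_open (@closed_closure _ (b i)) oU biU.
    by exists g; split => // _ x bx; apply: g1; exact: subset_closure.
  exists (fun=> 0); split => //; first by move=> x; exact: cvg_cst.
  by move=> _; rewrite lexx ler01.
(* [h m] is one minus the product of the [1 - g i] over [i < m]: it stays between 0 and 1, and
   equals 1 as soon as one of these [g i] does. *)
pose h := fix h m (x : K) : R :=
  if m is m'.+1 then h m' x + g m' x - h m' x * g m' x else 0.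
have h01 m x : 0 <= h m x <= 1.
  elim: m => [|m IHm] /=; first by rewrite lexx ler01.
  by have [_ /(_ x) g01 _ _] := gP m; nra.
exists h; split => //.
- elim=> [|m IHm] x /=; first exact: cvg_cst.
  have [cg _ _ _] := gP m.
  by apply: cvgB; [apply: cvgD|apply: cvgM];
    [exact: IHm|exact: cg|exact: IHm|exact: cg].
- move=> x Ux; have [V Vx VU] := regular_open oU Ux.
  have [i bix biV] := bP _ _ Vx.
  have gi1 : g i x = 1.
    have [_ _ /(_ _ x bix) -> //] := gP i.
    by apply: subset_trans VU; exact: closureS.
  near=> m; have : (i < m)%N by near: m; exact: nbhs_infty_gt.
  elim: {+}m => // m' IHm'; rewrite ltnS leq_eqVlt => /predU1P[<-|/IHm' /= ->].
    by rewrite /= gi1; ring.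
  by ring.
- move=> m x nUx; elim: m => //= m ->.
  by have [_ _ _ ->//] := gP m; ring.
Unshelve. all: by end_near. Qed.

Lemma continuous_Mintegrable (phi : K -> R) (f : borel K -> R) :
  continuous phi -> mu.-integrable setT (EFin \o f) ->
  mu.-integrable setT (EFin \o (fun x : borel K => phi x * f x)).
Proof.
move=> cphi fi; have [M _ phiM] := continuous_bounded cK cphi.
have := integrableMr measurableT (continuous_borel_measurable cphi) _ fi.
apply; exists M; split; first exact: num_real.
by move=> y My x _; apply: (le_trans (phiM x)); exact: ltW.
Qed.

(** Dominated convergence passes from continuous functions to indicators of open sets, and Dynkin
    induction from open sets, which are stable under intersection, to Borel sets. *)
Lemma integrable_annihilator (f : borel K -> R) :
  mu.-integrable setT (EFin \o f) ->
  (forall phi : K -> R, continuous phi -> \int[mu]_x (phi x * f x) = 0) ->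
  {ae mu, forall x, f x = 0}.
Proof.
move=> fi f0.
have mf : measurable_fun setT (EFin \o f) by case/integrableP : fi.
have nuopen (U : set K) : open U -> (\int[mu]_(x in U) (f x)%:E = 0)%E.
  move=> oU; have mU := open_borel_measurable oU.
  have [h [ch h01 h1 h0]] := open_indic_approx oU.
  have hi m := continuous_Mintegrable (ch m) fi.
  have hc x : (h m x * f x)%:E @[m --> \oo] --> ((EFin \o f) \_ U) x.
    rewrite patchE; case: ifPn => [/set_mem Ux|/negP nUx].
      apply: cvg_near_cst; have := h1 _ Ux; apply: filterS => m ->.
      by rewrite mul1r.
    apply: cvg_near_cst; apply: nearW => m.
    by rewrite h0 ?mul0r// => /mem_set.
  have [] := @dominated_convergence _ _ _ mu setT measurableT
    (fun m x => (h m x * f x)%:E) ((EFin \o f) \_ U) (fun x => `|(f x)%:E|%E).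
  - by move=> m; case/integrableP : (hi m).
  - exact: (measurable_restrictT (EFin \o f) mU).1 (measurable_funTS mf).
  - by apply: aeW => x _; exact: hc.
  - exact: integrable_abse.
  - apply: aeW => x m _ /=; rewrite lee_fin normrM ler_piMl// ger0_norm;
    by have /andP[] := h01 m x.
  move=> _ _; rewrite -integral_mkcond => cvg0.
  apply: (cvg_unique _ cvg0) => //.
  apply: cvg_near_cst; apply: nearW => m.
  have F : (\int[mu]_x (h m x * f x)%:E)%E \is a fin_num :=
    integrable_fin_num measurableT (hi m).
  have E : fine (\int[mu]_x (h m x * f x)%:E)%E = 0 := f0 _ (ch m).
  by apply: etrans (esym (fineK F)) _; rewrite E.
have nuA (A : set (borel K)) : measurable A -> (\int[mu]_(x in A) (f x)%:E = 0)%E.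
  move=> mA.
  apply: (@dynkin_induction _ (borel K) (@open K)
    (fun A => (\int[mu]_(x in A) (f x)%:E = 0)%E)) => //.
  - exact: openI.
  - by apply: nuopen; exact: openT.
  - move=> S mS S0; have := nuopen _ (@openT K).
    rewrite -[X in integral _ X](setUv S) integral_setU//=.
    - by rewrite S0 add0e.
    - exact: measurableC.
    - by rewrite setUv.
    - exact/disj_setPCl.
  - move=> F mF tF F0; rewrite integral_bigcup//.
    - by rewrite eseries0.
    - by apply: (integrableS measurableT) => //; exact: bigcupT_measurable.
have := @integral_ae_eq _ _ _ mu setT measurableT (cst 0%E) (EFin \o f) fi
  (measurable_cst _).
have H : forall E : set (borel K), E `<=` setT -> measurable E ->
    (\int[mu]_(x in E) (EFin \o f) x = \int[mu]_(x in E) cst 0 x)%E.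
  by move=> E _ mE; rewrite integral0; exact: nuA.
move=> /(_ H); apply: filterS => x /(_ I) [].
by [].
Qed.

End Density.

(** * Convolution operators *)

Section Convolution.
Context (R : realType) (K : ptopGroupType) (mu : probability (borel K) R).
Hypothesis cK : compact [set: K].
Hypothesis scK : @second_countable K.
Hypothesis cmulK : continuous (fun x : K * K => (x.1 * x.2)%g).
Hypothesis cinvK : continuous (fun x : K => x^-1%g).
Hypothesis haar : is_haar mu.

Local Notation intg f := (mu.-integrable [set: borel K] (EFin \o (f : borel K -> R))).

(* With [phi (x^-1 * y)] as kernel the operator commutes with left translations,
   and left invariance of mu suffices for everything below. *)
Definition rconv (phi f : K -> R) (x : K) : R :=
  \int[mu]_y (phi (x^-1 * y)%g * f y).

Lemma continuous_divgl : continuous (fun p : K * K => (p.1^-1 * p.2)%g).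
Proof.
move=> p; apply: (@continuous_comp _ _ _ (fun p : K * K => (p.1^-1%g, p.2))
  (fun x : K * K => (x.1 * x.2)%g)); last exact: cmulK.
apply: cvg_pair; last exact: cvg_snd.
by apply: (continuous_comp (f := fst)); [exact: cvg_fst|exact: cinvK].
Qed.

Lemma continuous_kernel (phi : K -> R) : continuous phi ->
  continuous (fun p : K * K => phi (p.1^-1 * p.2)%g).
Proof.
move=> cphi p.
apply: (@continuous_comp _ _ _ (fun p : K * K => (p.1^-1 * p.2)%g) phi).
  exact: continuous_divgl.
exact: cphi.
Qed.

Lemma continuous_lshift (f : K -> R) g :
  continuous f -> continuous (fun x => f (g * x)%g).
Proof.
move=> cf x; apply: (@continuous_comp _ _ _ (fun x : K => (g * x)%g) f).
  exact: continuous_mulgl.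
exact: cf.
Qed.

Lemma rconv_integrable (phi f : K -> R) x : continuous phi -> intg f ->
  intg (fun y => phi (x^-1 * y)%g * f y).
Proof.
by move=> cphi fi; apply: continuous_Mintegrable => //; exact: continuous_lshift.
Qed.

Lemma integrable_normr (f : K -> R) : intg f -> intg (fun x => `|f x|).
Proof. by move=> /integrable_abse; apply: eq_integrable. Qed.

Lemma integrable_scale (f : K -> R) c : intg f -> intg (fun x => c * f x).
Proof. by move=> /(integrableZl measurableT c); apply: eq_integrable. Qed.

Lemma normr_Rintegral_le (g f : K -> R) M : continuous g -> intg f ->
  (forall x, `|g x| <= M) ->
  `|\int[mu]_x (g x * f x)| <= M * \int[mu]_x `|f x|.
Proof.
move=> cg fi gM; have gfi := continuous_Mintegrable cK cg fi.
apply: le_trans (le_normr_Rintegral measurableT gfi) _.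
have nfi := integrable_normr fi.
rewrite -RintegralZl//; apply: le_Rintegral => //.
- exact: (integrable_normr gfi).
- exact: integrable_scale.
- by move=> x _; rewrite normrM ler_wpM2r.
Qed.

Lemma rconv_le (phi f : K -> R) M x : continuous phi -> intg f ->
  (forall x, `|phi x| <= M) -> `|rconv phi f x| <= M * \int[mu]_x `|f x|.
Proof.
by move=> cphi fi phiM; apply: normr_Rintegral_le => //; exact: continuous_lshift.
Qed.

Lemma rconv_dist_le (phi f : K -> R) d x x' : continuous phi -> intg f ->
  (forall y, `|phi (x^-1 * y)%g - phi (x'^-1 * y)%g| <= d) ->
  `|rconv phi f x - rconv phi f x'| <= d * \int[mu]_x `|f x|.
Proof.
move=> cphi fi phid; rewrite /rconv -RintegralB//; try exact: rconv_integrable.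
under eq_Rintegral do rewrite -mulrBl.
apply: (@normr_Rintegral_le (fun y => phi (x^-1 * y)%g - phi (x'^-1 * y)%g)) => //.
by move=> y; apply: cvgB; exact: continuous_lshift.
Qed.

Lemma rconv_continuous (phi f : K -> R) : continuous phi -> intg f ->
  continuous (rconv phi f).
Proof.
move=> cphi fi x; apply/cvgrPdist_lt => e e0.
set N := \int[mu]_x `|f x|.
have N0 : 0 <= N by apply: Rintegral_ge0.
(* The denominator is [N + 1] because [N] may be 0. *)
have d0 : 0 < e / (N + 1) by rewrite divr_gt0// ltr_wpDl.
have := continuous_tube cK x (continuous_kernel cphi) d0.
apply: filterS => x' /= H.
apply: (@le_lt_trans _ _ (e / (N + 1) * N)).
  by apply: rconv_dist_le => // y; exact/ltW/H.
by rewrite -mulrA gtr_pMr// mulrC ltr_pdivrMr ?ltr_wpDl// mul1r ltrDl.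
Qed.

(** The kernel is unchanged when both variables are multiplied on the left by [g], so the
    substitution of [g * y] for [y] gives the claim. *)
Lemma rconv_mulgl (phi f : K -> R) g x : continuous phi -> intg f ->
  rconv phi (fun y => f (g * y)%g) x = rconv phi f (g * x)%g.
Proof.
move=> cphi fi; rewrite /rconv.
rewrite -[RHS](haar_integral cmulK haar g); last exact: rconv_integrable.
by apply: eq_Rintegral => y _; rewrite invgM !mulgA mulgVK.
Qed.

(** The kernel is bounded and jointly measurable, so the integrand is dominated by a multiple of the
    product of two integrable functions in separate variables. *)
Lemma rconv_Fubini (phi f g : K -> R) : continuous phi -> intg f -> intg g ->
  \int[mu]_x (rconv phi f x * g x) =
  \int[mu]_y (f y * \int[mu]_x (phi (x^-1 * y)%g * g x)).
Proof.
move=> cphi fi gi.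
pose H (p : borel K * borel K) : \bar R :=
  (phi (p.1^-1 * p.2)%g * f p.2 * g p.1)%:E.
have mf : measurable_fun setT (f : borel K -> R).
  by apply/measurable_EFinP; case/integrableP : fi.
have mg : measurable_fun setT (g : borel K -> R).
  by apply/measurable_EFinP; case/integrableP : gi.
have mH : measurable_fun setT H.
  apply/measurable_EFinP; apply: measurable_funM; first apply: measurable_funM.
  - exact: (continuous_measurable_prod scK (continuous_kernel cphi)).
  - exact: (measurableT_comp mf measurable_snd).
  - exact: (measurableT_comp mg measurable_fst).
have Hx x : (\int[mu]_y H (x, y) = (rconv phi f x * g x)%:E)%E.
  rewrite /rconv -RintegralZr//; last exact: rconv_integrable.
  rewrite /Rintegral fineK//; apply: (integrable_fin_num measurableT).
  have := integrable_scale (g x) (rconv_integrable x cphi fi).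
  by apply: eq_integrable => // y _ /=; rewrite [in RHS]mulrC.
have cphiy y : continuous (fun x : K => phi (x^-1 * y)%g).
  move=> x; apply: (@continuous_comp _ _ _ (fun x : K => (x, y))
    (fun p : K * K => phi (p.1^-1 * p.2)%g)); last exact: continuous_kernel.
  by apply: cvg_pair; [exact: cvg_id|exact: cvg_cst].
have phiyi y : intg (fun x => phi (x^-1 * y)%g * g x).
  exact: continuous_Mintegrable.
have Hy y : (\int[mu]_x H (x, y) =
    (f y * \int[mu]_x (phi (x^-1 * y)%g * g x))%:E)%E.
  rewrite -RintegralZl// /Rintegral fineK//; last first.
    apply: (integrable_fin_num measurableT).
    exact: integrable_scale.
  by apply: eq_integral => x _; rewrite /H /=; congr EFin; ring.
have iH : (mu \x mu)%E.-integrable setT H.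
  apply/integrable12ltyP => //.
  have [M M0 phiM] := continuous_bounded cK cphi.
  pose C := M * \int[mu]_x `|f x|.
  have Cg := integrable_scale C (integrable_normr gi).
  apply: (@le_lt_trans _ _ (\int[mu]_x (C * `|g x|)%:E)%E); last first.
    exact: integrable_lty Cg.
  apply: ge0_le_integral => //=.
  - by move=> x _; exact: integral_ge0.
  - apply: (measurable_fun_fubini_tonelli_F (abse \o H)) => //=.
    exact: measurableT_comp.
  - by case/integrableP : Cg.
  - move=> x _.
    have := integrable_scale (M * `|g x|) (integrable_normr fi) => h.
    apply: (@le_trans _ _ (\int[mu]_y ((M * `|g x|) * `|f y|)%:E)%E).
      apply: ge0_le_integral => //=.
      - apply/measurable_EFinP; apply: measurableT_comp => //.
        apply: measurable_funM => //; apply: measurable_funM => //.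
        exact: (continuous_borel_measurable (@continuous_lshift _ (x^-1)%g cphi)).
      - by case/integrableP : h.
      - move=> y _; rewrite lee_fin !normrM.
        by rewrite mulrAC ler_wpM2r// ler_wpM2r.
    have F : (\int[mu]_y ((M * `|g x|) * `|f y|)%:E)%E \is a fin_num :=
      integrable_fin_num measurableT h.
    rewrite -(fineK F) lee_fin.
    have := RintegralZl (M * `|g x|) measurableT (integrable_normr fi).
    by rewrite /Rintegral => ->; rewrite /C mulrAC.
have := Fubini iH.
under eq_integral do rewrite Hx.
under [X in _ = X -> _]eq_integral do rewrite Hy.
by rewrite /Rintegral => ->.
Qed.

(** Fubini against the constant 1: the integral of the kernel over its first variable does not
    depend on the second, by left invariance. In particular mean 0 is preserved. *)
Lemma rconv_mean (phi f : K -> R) : continuous phi -> intg f ->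
  \int[mu]_x rconv phi f x = (\int[mu]_x phi (x^-1)%g) * \int[mu]_x f x.
Proof.
move=> cphi fi.
have i1 : intg (fun=> 1).
  by apply: continuous_integrable => // x; exact: cvg_cst.
have cphiV : continuous (fun x : K => phi (x^-1)%g).
  move=> x; apply: (@continuous_comp _ _ _ (fun x : K => x^-1%g) phi).
    exact: cinvK.
  exact: cphi.
have := rconv_Fubini cphi fi i1; under eq_Rintegral do rewrite mulr1.
move=> ->; rewrite -RintegralZl//; apply: eq_Rintegral => y _.
rewrite mulrC; congr (_ * _); under eq_Rintegral do rewrite mulr1.
rewrite -[RHS](haar_integral cmulK haar (y^-1)%g (f := fun x => phi (x^-1)%g));
  last exact: continuous_integrable.
by apply: eq_Rintegral => x _; rewrite invgM invgK.
Qed.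

Lemma rconv_sym (phi f g : K -> R) : continuous phi -> intg f -> intg g ->
  (forall x, phi (x^-1)%g = phi x) ->
  \int[mu]_x (rconv phi f x * g x) = \int[mu]_x (f x * rconv phi g x).
Proof.
move=> cphi fi gi phiV; rewrite rconv_Fubini//.
apply: eq_Rintegral => y _; congr (_ * _).
by apply: eq_Rintegral => x _; rewrite -phiV invgM invgK.
Qed.

End Convolution.

(** * Approximate identities and compactness of convolution *)

Section ConvolutionCompact.
Context (R : realType) (K : ptopGroupType) (mu : probability (borel K) R).
Hypothesis hK : hausdorff_space K.
Hypothesis cK : compact [set: K].
Hypothesis cmulK : continuous (fun x : K * K => (x.1 * x.2)%g).
Hypothesis cinvK : continuous (fun x : K => x^-1%g).
Hypothesis haar : is_haar mu.

Local Notation intg f := (mu.-integrable [set: borel K] (EFin \o (f : borel K -> R))).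

(** The kernel is a bump at 1 supported where right translation moves [f] uniformly by less than
    [e], made symmetric and normalized to mass 1. *)
Lemma rconv_approx (f : K -> R) e : continuous f -> 0 < e ->
  exists phi : K -> R, [/\ continuous phi, forall x, phi (x^-1)%g = phi x &
    forall x, `|rconv mu phi f x - f x| <= e].
Proof.
move=> cf e0.
have ch : continuous (fun p : K * K => f (p.2 * p.1)%g).
  move=> p; apply: (@continuous_comp _ _ _ (fun p : K * K => (p.2 * p.1)%g) f).
    apply: (@continuous_comp _ _ _ (fun p : K * K => (p.2, p.1))
      (fun x : K * K => (x.1 * x.2)%g)); last exact: cmulK.
    by apply: cvg_pair; [exact: cvg_snd|exact: cvg_fst].
  exact: cf.
have : nbhs (1%g : K) [set u | forall y, `|f (y * 1)%g - f (y * u)%g| < e].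
  exact: (continuous_tube cK (1%g : K) ch e0).
rewrite nbhsE => -[U [oU U1] Uf].
pose V := U `&` [set x | U (x^-1)%g].
have oV : open V.
  by apply: openI => //; have /continuousP := cinvK; apply.
have V1 : V 1%g by split => //=; rewrite invg1.
have c1 := accessible_closed_set1 (hausdorff_accessible hK) (x := 1%g).
have sV : [set 1%g] `<=` V by move=> _ ->.
have [psi [cpsi psi01 psi1 psi0]] := @urysohn_open R K hK cK _ _ c1 oV sV.
have cpsiV : continuous (fun x : K => psi (x^-1)%g).
  move=> x; apply: (@continuous_comp _ _ _ (fun x : K => x^-1%g) psi).
    exact: cinvK.
  exact: cpsi.
pose phi0 x := psi x + psi (x^-1)%g.
have cphi0 : continuous phi0 by move=> x; apply: cvgD; [exact: cpsi|exact: cpsiV].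
have phi0_ge0 x : 0 <= phi0 x.
  by rewrite addr_ge0//; [have /andP[] := psi01 x|have /andP[] := psi01 (x^-1)%g].
pose m := \int[mu]_x phi0 x.
have m0 : 0 < m.
  apply: (haar_integral_gt0 cK cmulK haar (x := 1%g)) => //.
  by rewrite /phi0 invg1 psi1// addr_gt0.
pose phi x := m^-1 * phi0 x.
have cphi : continuous phi by move=> x; apply: cvgM; [exact: cvg_cst|exact: cphi0].
have phi_ge0 x : 0 <= phi x by rewrite mulr_ge0// invr_ge0 ltW.
have phi_supp x : ~ V x -> phi x = 0.
  move=> nVx; rewrite /phi /phi0 !psi0 ?addr0 ?mulr0//.
  by rewrite /V /= invgK => -[? ?]; exact: nVx.
have cphix x : continuous (fun y : K => phi (x^-1 * y)%g).
  exact: continuous_lshift.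
have phix_int x : intg (fun y => phi (x^-1 * y)%g) by exact: continuous_integrable.
have phi1 x : \int[mu]_y phi (x^-1 * y)%g = 1.
  rewrite (haar_integral cmulK haar (x^-1)%g (f := phi)); last first.
    exact: continuous_integrable.
  rewrite RintegralZl//; last exact: continuous_integrable.
  by rewrite -/m mulVf// gt_eqF.
exists phi; split => // [x|x].
  by rewrite /phi /phi0 invgK addrC.
have fi : intg f by exact: continuous_integrable.
have phifi := rconv_integrable cK cmulK x cphi fi.
have phii := integrable_scale (f x) (phix_int x).
(* Since the kernel has mass 1, [f x] becomes an integral against it, and the difference becomes an
   average of [f y - f x] over the [y] with [x^-1 * y] in [V]. *)
rewrite -[X in _ - X]mulr1 -(phi1 x) -RintegralZl//.
rewrite /rconv -RintegralB//.
have dint : intg (fun y => phi (x^-1 * y)%g * f y - f x * phi (x^-1 * y)%g).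
  by have := integrableB measurableT phifi phii; apply: eq_integrable.
apply: le_trans (le_normr_Rintegral measurableT dint) _.
rewrite -[leRHS]mulr1 -(phi1 x) -RintegralZl//.
apply: le_Rintegral => //; [exact: integrable_normr|exact: integrable_scale|].
move=> y _ /=; rewrite [f x * _]mulrC -mulrBr normrM ger0_norm// mulrC.
have [Vy|nVy] := pselect (V (x^-1 * y)%g); last by rewrite phi_supp// !mulr0.
rewrite ler_wpM2r//; have [/Uf/(_ x) + _] := Vy.
by rewrite mulg1 mulVKg distrC => /ltW.
Qed.

(** Arzela-Ascoli: convolution by [phi] sends the unit ball of L^1 to an equicontinuous, uniformly
    bounded family. A cluster point for compact convergence is a uniform one as [K] is compact;
    indices [k] beyond every [N] take the place of a subsequence. *)
Lemma rconv_cluster (phi : K -> R) (u : nat -> K -> R) : continuous phi ->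
  (forall k, intg (u k)) -> (forall k, \int[mu]_x `|u k x| <= 1) ->
  exists2 h : K -> R, continuous h & forall e N, 0 < e ->
    exists2 k, (N <= k)%N & forall x, `|rconv mu phi (u k) x - h x| <= e.
Proof.
move=> cphi ui u1.
pose W : set (K -> R) := range (fun k => rconv mu phi (u k)).
have [M M0 phiM] := continuous_bounded cK cphi.
have equiW : equicontinuous W id.
  move=> x E; rewrite -entourage_ballE => -[d /= d0 dE].
  have d20 : 0 < d / 2 by rewrite divr_gt0.
  have := continuous_tube cK x (continuous_kernel cmulK cinvK cphi) d20.
  apply: filterS => x' H _ [k _ <-]; apply: dE; rewrite /= /ball /=.
  apply: (@le_lt_trans _ _ (d / 2 * \int[mu]_x `|u k x|)).
    by apply: rconv_dist_le => // y; exact/ltW/H.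
  apply: (@le_lt_trans _ _ (d / 2 * 1)); first by rewrite ler_wpM2l// ltW.
  by lra.
have preW : pointwise_precompact W id.
  move=> x; apply: (@precompact_subset _ _ `[- M, M]%classic).
    move=> _ [_ [k _ <-] <-] /=; rewrite in_itv/= -ler_norml.
    apply: le_trans (rconv_le cK cmulK x cphi (ui k) phiM) _.
    by rewrite -[leRHS]mulr1 ler_wpM2l// ltW.
  by apply: compact_precompact; [exact: Rhausdorff|exact: segment_compact].
have := pointwise_precompact_equicontinuous preW equiW.
rewrite precompactE => cptW.
pose F := (fun k => rconv mu phi (u k)) @ \oo.
have FW : F (closure (W : set {family compact, K -> R})).
  by exists 0%N => // k _ /=; apply: subset_closure; exists k.
have [h [_ hF]] := cptW (@Rhausdorff R) F _ FW.
have near e N : 0 < e -> exists2 k, (N <= k)%N &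
    forall x, `|rconv mu phi (u k) x - h x| < e.
  move=> e0.
  have FN : F [set rconv mu phi (u k) | k in [set k | (N <= k)%N]].
    by exists N => // k Nk /=; exists k.
  have entE : entourage [set p : R * R | ball p.1 e p.2].
    by rewrite -entourage_ballE; exists e.
  have [_ [[k Nk <-] hk]] := hF _ _ FN (fam_nbhs h entE cK).
  by exists k => // x; have := hk x I; rewrite /ball /= distrC.
exists h; last by move=> e N /(near e N)[k Nk H]; exists k => // x; exact/ltW.
(* A uniform limit of continuous functions is continuous, by the three-epsilon argument. *)
move=> x; apply/cvgrPdist_lt => e e0.
have e30 : 0 < e / 3 by rewrite divr_gt0.
have [k _ H] := near _ 0%N e30.
have /cvgrPdist_lt/(_ _ e30) := rconv_continuous cK cmulK cinvK cphi (ui k) (x := x).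
apply: filterS => y /= xy.
have := H x; have := H y.
move: xy; rewrite !ltr_norml => /andP[? ?] /andP[? ?] /andP[? ?]; lra.
Unshelve. all: by end_near. Qed.

End ConvolutionCompact.

(** * Symmetric operators commuting with a compact one *)

Section PreHilbert.
Context (R : realType) (V : lmodType R) (C : set V) (dot : V -> V -> R).

Definition lsubspace (E : set V) :=
  E 0 /\ forall (a : R) f g, E f -> E g -> E (a *: f + g).

(** The axioms are relative to [E] since the integral is bilinear only on well-behaved functions,
    and semidefinite forms are allowed so that Cauchy-Schwarz also applies to
    [b * dot f g - dot (S f) g]. *)
Definition psd (E : set V) (B : V -> V -> R) :=
  [/\ forall f g, E f -> E g -> B f g = B g f,
      forall (a : R) f g h, E f -> E g -> E h ->
        B (a *: f + g) h = a * B f h + B g h &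
      forall f, E f -> 0 <= B f f].

Lemma lsubspaceD E f g : lsubspace E -> E f -> E g -> E (f + g).
Proof. by move=> [_ EP] Ef Eg; rewrite -[f]scale1r; exact: EP. Qed.

Lemma lsubspaceZ E a f : lsubspace E -> E f -> E (a *: f).
Proof. by move=> [E0 EP] Ef; rewrite -[_ *: _]addr0; exact: EP. Qed.

Lemma lsubspaceB E f g : lsubspace E -> E f -> E g -> E (f - g).
Proof. by move=> [_ EP] Ef Eg; rewrite addrC -scaleN1r; exact: EP. Qed.

Lemma psdZ E B a f h : lsubspace E -> psd E B -> E f -> E h ->
  B (a *: f) h = a * B f h.
Proof.
move=> [E0 _] [_ BP _] Ef Eh; rewrite -[a *: f]addr0 BP//.
have : B (0 *: 0 + 0) h = 0 * B 0 h + B 0 h by apply: BP.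
by rewrite scale0r addr0 mul0r add0r => _; have := BP 1 0 0 h E0 E0 Eh;
  rewrite scaler0 addr0 mul1r => /eqP; rewrite -subr_eq0 => /eqP; lra.
Qed.

Lemma psd_expand E B a f g : lsubspace E -> psd E B -> E f -> E g ->
  B (a *: f + g) (a *: f + g) = a ^+ 2 * B f f + 2 * a * B f g + B g g.
Proof.
move=> sE pB Ef Eg; have [BC BD _] := pB.
have Eaf := lsubspaceZ a sE Ef; have Eh := lsubspaceD sE Eaf Eg.
rewrite BD// (BC f)// (BC g (_ + _))// !BD// (BC g f)//; ring.
Qed.

Lemma psd_CS E B f g : lsubspace E -> psd E B -> E f -> E g ->
  B f g ^+ 2 <= B f f * B g g.
Proof.
move=> sE pB Ef Eg.
have H t : 0 <= t ^+ 2 * B f f + 2 * t * B f g + B g g.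
  rewrite -(psd_expand t sE pB Ef Eg); have [_ _] := pB; apply.
  by apply: lsubspaceD => //; exact: lsubspaceZ.
have [_ _ B0] := pB; have := B0 _ Ef; rewrite le_eqVlt => /predU1P[ff0|ff0].
  rewrite -ff0 mul0r; have [->|fg0] := eqVneq (B f g) 0; first by rewrite expr0n.
  (* When [B f f = 0] the quadratic polynomial in [t] is affine, and it takes the value -1 at this
     point. *)
  have := H (- (B g g + 1) / (2 * B f g)); rewrite -ff0 mulr0 add0r.
  rewrite (_ : _ + _ = -1); first by lra.
  by field.
(* This is where the quadratic polynomial attains its minimum. *)
have := H (- B f g / B f f).
rewrite (_ : _ + _ = (B f f * B g g - B f g ^+ 2) / B f f); last first.
  by field; rewrite gt_eqF.
by rewrite pmulr_lge0 ?invr_gt0// subr_ge0.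
Qed.

(** The parallelogram law with the term of [f - g] dropped; it replaces the triangle inequality and
    avoids square roots. *)
Lemma psd_parallelogram E B f g : lsubspace E -> psd E B -> E f -> E g ->
  B (f + g) (f + g) <= 2 * B f f + 2 * B g g.
Proof.
move=> sE pB Ef Eg.
have e1 := psd_expand 1 sE pB Ef Eg; have e2 := psd_expand (-1) sE pB Ef Eg.
have : 0 <= B (-1 *: f + g) (-1 *: f + g).
  have [_ _] := pB; apply; apply: lsubspaceD => //; exact: lsubspaceZ.
by rewrite -[f in B (f + g) _]scale1r -[f in B _ (f + g)]scale1r e1 e2; lra.
Qed.

(** [M] bounds squared norms, so it plays the part of the square of an operator norm. *)
Definition linear_bounded (E : set V) (S : V -> V) :=
  [/\ forall f, E f -> E (S f),
      forall (a : R) f g, E f -> E g -> S (a *: f + g) = a *: S f + S g &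
      exists2 M, 0 <= M & forall f, E f -> dot (S f) (S f) <= M * dot f f].

Definition symmetric_on (E : set V) (S : V -> V) :=
  forall f g, E f -> E g -> dot (S f) g = dot f (S g).

Hypothesis sC : lsubspace C.
Hypothesis pdot : psd C dot.

Lemma sub_psd E B : psd C B -> E `<=` C -> psd E B.
Proof.
move=> [BC BD B0] EC; split=> [f g /EC ? /EC ?|a f g h /EC ? /EC ? /EC ?|f /EC ?].
- exact: BC.
- exact: BD.
- exact: B0.
Qed.

Lemma linear_boundedZ S a f : linear_bounded C S -> C f -> S (a *: f) = a *: S f.
Proof.
move=> [_ SD _] Cf; have [C0 _] := sC.
have := SD (-1) _ _ C0 C0; rewrite !scaleN1r oppr0 addr0 addNr => S0.
by have := SD a _ _ Cf C0; rewrite addr0 S0 addr0.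
Qed.

Lemma linear_boundedB S f g : linear_bounded C S -> C f -> C g ->
  S (f - g) = S f - S g.
Proof.
by move=> [_ SD _] Cf Cg; rewrite addrC -scaleN1r SD// scaleN1r addrC.
Qed.

Lemma linear_bounded_comp S1 S2 : linear_bounded C S1 -> linear_bounded C S2 ->
  linear_bounded C (S1 \o S2).
Proof.
move=> [s1 l1 [M1 M10 b1]] [s2 l2 [M2 M20 b2]]; split => /=.
- by move=> f /s2/s1.
- by move=> a f g Cf Cg; rewrite l2// l1//; exact: s2.
- exists (M1 * M2); first exact: mulr_ge0.
  move=> f Cf; apply: le_trans (b1 _ (s2 _ Cf)) _.
  by rewrite -mulrA ler_wpM2l// b2.
Qed.

Lemma linear_bounded_lin S1 S2 c : linear_bounded C S1 -> linear_bounded C S2 ->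
  linear_bounded C (fun f => c *: S1 f + S2 f).
Proof.
move=> [s1 l1 [M1 M10 b1]] [s2 l2 [M2 M20 b2]]; split => /=.
- by move=> f Cf; apply: lsubspaceD => //; [apply: lsubspaceZ => //; exact: s1|exact: s2].
- move=> a f g Cf Cg; rewrite l1// l2// !scalerDr !scalerA (mulrC c) !addrA.
  by congr (_ + _); rewrite addrAC.
- exists (2 * (c ^+ 2 * M1) + 2 * M2).
    by rewrite addr_ge0// mulr_ge0// mulr_ge0// sqr_ge0.
  move=> f Cf.
  have C1 := s1 _ Cf; have C2 := s2 _ Cf.
  have C1c := lsubspaceZ c sC C1.
  apply: le_trans (psd_parallelogram sC pdot C1c C2) _.
  have [dC _ _] := pdot.
  rewrite (psdZ c sC pdot)// (dC (S1 f))// (psdZ c sC pdot)//.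
  have := b2 _ Cf; have := b1 _ Cf; have := sqr_ge0 c.
  move=> c0 b1f b2f.
  have : c ^+ 2 * dot (S1 f) (S1 f) <= c ^+ 2 * (M1 * dot f f) by rewrite ler_wpM2l.
  by lra.
Qed.

(** Near-maximizers of the Rayleigh quotient are approximate eigenvectors. With [b] the supremum,
    the form [B] of [b - S] is semidefinite, and Cauchy-Schwarz for [B] bounds the residual
    [r = S f - b f] in terms of the small number [B f f]. *)
Lemma rayleigh_sup E S f0 : lsubspace E -> E `<=` C -> linear_bounded C S ->
  (forall f, E f -> E (S f)) -> symmetric_on E S -> E f0 -> 0 < dot f0 f0 ->
  exists b, (forall f, E f -> dot (S f) f <= b * dot f f) /\
    forall e, 0 < e -> exists2 f, E f /\ dot f f = 1 &
      dot (S f - b *: f) (S f - b *: f) <= e.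
Proof.
move=> sE EC lS ES symS Ef0 f00.
have [_ SD [M M0 SM]] := lS.
have pE := sub_psd pdot EC; have [dC dD d0] := pE.
pose A := [set dot (S f) f | f in [set f | E f /\ dot f f = 1]].
have norm_in f : E f -> 0 < dot f f ->
    A (dot (S f) f / dot f f) .
  move=> Ef f_gt0; pose c := (Num.sqrt (dot f f))^-1.
  have c2 : c * c = (dot f f)^-1.
    by rewrite -expr2 exprVn sqr_sqrtr// ltW.
  have ESf := ES _ Ef; have Ecf := lsubspaceZ c sE Ef.
  exists (c *: f); first split => //.
    by rewrite (psdZ c sE pE)// dC// (psdZ c sE pE)// mulrA c2 mulVf// gt_eqF.
  rewrite (linear_boundedZ c lS (EC _ Ef)) (psdZ c sE pE)// dC//.
  by rewrite (psdZ c sE pE)// mulrA c2 mulrC dC.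
(* Cauchy-Schwarz gives the square root of [M] as a factor; [M + 1] is a larger one free of
   roots. *)
have absS f : E f -> `|dot (S f) f| <= (M + 1) * dot f f.
  move=> Ef; have ESf := ES _ Ef.
  have := psd_CS sE pE ESf Ef; have := SM _ (EC _ Ef); have := d0 _ Ef.
  move=> ff0 SSM CS; rewrite -(@ler_pXn2r _ 2) ?nnegrE//; last first.
    by rewrite mulr_ge0// addr_ge0.
  rewrite real_normK ?num_real//; apply: le_trans CS _.
  apply: (@le_trans _ _ ((M * dot f f) * dot f f)); first by rewrite ler_wpM2r.
  by nra.
have ubA : ubound A (M + 1).
  move=> _ [f [Ef f1] <-]; have := absS _ Ef; rewrite f1 mulr1.
  by apply: le_trans; exact: ler_norm.
have supA : has_sup A by split; [eexists; exact: norm_in Ef0 f00|exists (M + 1)].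
pose b := sup A.
have Sb f : E f -> dot (S f) f <= b * dot f f.
  move=> Ef; have := d0 _ Ef; rewrite le_eqVlt => /predU1P[ff0|f_gt0].
    by have := absS _ Ef; rewrite -ff0 !mulr0 normr_le0 => /eqP->.
  by rewrite -ler_pdivrMr//; apply: sup_ubound; [case: supA|exact: norm_in].
exists b; split=> // e e0.
pose B f g := b * dot f g - dot (S f) g.
have pB : psd E B.
  split=> [f g Ef Eg|a f g h Ef Eg Eh|f Ef]; rewrite /B.
  - by rewrite (dC f)// symS// (dC _ (S g))//; exact: ES.
  - rewrite SD; [|exact: EC..].
    by rewrite !dD//; [ring|exact: ES..].
  - by rewrite subr_ge0; exact: Sb.
pose N := `|b| + (M + 1).
have N0 : 0 < N by rewrite ltr_wpDl// ltr_wpDl.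
have eN0 : 0 < e / N by rewrite divr_gt0.
have [_ [f [Ef f1] <-] Sf] := sup_adherent eN0 supA.
exists f => //; set r := S f - _.
have Er : E r by apply: lsubspaceB => //; [exact: ES|exact: lsubspaceZ].
have rr0 := d0 _ Er.
have Bfr : B f r = - dot r r.
  have -> : dot r r = - b * dot f r + dot (S f) r.
    by rewrite -dD//; [congr dot; rewrite /r scaleNr addrC|exact: ES].
  by rewrite /B; ring.
have Brr : B r r <= N * dot r r.
  have := absS _ Er; have := ler_norm (- dot (S r) r); rewrite normrN.
  have : b * dot r r <= `|b| * dot r r by rewrite ler_wpM2r// ler_norm.
  by rewrite /B /N; lra.
have [_ _ B0] := pB.
have Bff : B f f < e / N by rewrite /B f1 mulr1; move: Sf; rewrite -/b; lra.
have := psd_CS sE pB Ef Er; rewrite Bfr sqrrN => CS.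
have CS' : dot r r ^+ 2 <= B f f * (N * dot r r).
  by apply: le_trans CS _; rewrite ler_wpM2l// B0.
move: rr0; rewrite le_eqVlt => /predU1P[<-|r_gt0]; first exact: ltW.
(* As [B f r = - dot r r], Cauchy-Schwarz bounds the square of [dot r r] by [B f f * (N * dot r r)];
   one factor cancels. *)
have : dot r r <= B f f * N.
  by rewrite -(ler_pM2r r_gt0) -mulrA -expr2.
move=> /le_trans; apply; rewrite -ler_pdivlMr//; exact: ltW.
Qed.

(** The residual at [h] differs from the residual at [f] by the bounded operator [S - b] applied to
    [f - h], so it is arbitrarily small. The limit is nonzero because the [f] are unit vectors. *)
Lemma cluster_eigenvector E S b h : linear_bounded C S -> E `<=` C -> C h ->
  (forall e, 0 < e -> exists f, [/\ E f, dot f f = 1,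
     dot (S f - b *: f) (S f - b *: f) <= e & dot (f - h) (f - h) <= e]) ->
  dot (S h - b *: h) (S h - b *: h) = 0 /\ 0 < dot h h.
Proof.
move=> lS EC Ch H; have [CS SD [M M0 SM]] := lS; have [dC dD d0] := pdot.
split.
  apply/eqP; rewrite eq_le d0 ?andbT; last first.
    by apply: lsubspaceB => //; [exact: CS|exact: lsubspaceZ].
  apply/ler_addgt0Pl => e e0; rewrite addr0.
  (* Two uses of the parallelogram bound give [2 * (2 * M + 2 * b ^+ 2) + 2] times the allowed
     error. *)
  pose N := 4 * M + 4 * b ^+ 2 + 2.
  have N0 : 0 < N by rewrite /N; have := sqr_ge0 b; lra.
  have eN0 : 0 < e / N by rewrite divr_gt0.
  have [f [/EC Cf _ f1 f2]] := H _ eN0.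
  pose u := f - h; have Cu : C u by exact: lsubspaceB.
  pose v := S f - b *: f.
  have Cv : C v by apply: lsubspaceB => //; [exact: CS|exact: lsubspaceZ].
  have -> : S h - b *: h = (-1 *: (S u - b *: u)) + v.
    rewrite /v /u (linear_boundedB lS Cf Ch) scalerBr scaleN1r !opprB !addrA.
    by rewrite addrNK [RHS]addrC !addrA addNr add0r addrC.
  have Cw : C (S u - b *: u) by apply: lsubspaceB => //; [exact: CS|exact: lsubspaceZ].
  apply: le_trans (psd_parallelogram sC pdot (lsubspaceZ (-1) sC Cw) Cv) _.
  rewrite (psdZ (-1) sC pdot)//; last exact: lsubspaceZ.
  rewrite (dC (S u - _))//; last exact: lsubspaceZ.
  rewrite (psdZ (-1) sC pdot)//.
  have Cbu := lsubspaceZ (- b) sC Cu.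
  have := psd_parallelogram sC pdot (CS _ Cu) Cbu.
  rewrite (psdZ (-b) sC pdot)// (dC u)// (psdZ (-b) sC pdot)// -scaleNr.
  have := SM _ Cu.
  have : e = N * (e / N) by rewrite mulrC divfK// gt_eqF.
  move: f1 f2; rewrite -/u -/v /N; set d := e / _; have := sqr_ge0 b.
  set uu := dot u u => b0 f1 f2 eE h1 h2.
  have : b ^+ 2 * uu <= b ^+ 2 * d by rewrite ler_wpM2l.
  have : M * uu <= M * d by rewrite ler_wpM2l.
  by lra.
have e40 : (0 : R) < 1 / 4 by lra.
have [f [/EC Cf f1 _ f2]] := H _ e40.
have Cu : C (f - h) by exact: lsubspaceB.
have := psd_parallelogram sC pdot Cu Ch; rewrite subrK f1; lra.
Qed.

Hypothesis dot_def : forall f, C f -> dot f f = 0 -> f = 0.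

(** No completeness is assumed: limits come from clustering of the images under [A]. A unit vector
    [u] with [S u] close to [b u] is close to [b^-1 *: W (A u)], so a cluster point [h] of the [A u]
    yields the candidate [b^-1 *: W h] in [C]. *)
Lemma compact_commutant_eigenvector T A c g :
  linear_bounded C T -> linear_bounded C A ->
  symmetric_on C T -> symmetric_on C A -> (forall f, C f -> T (A f) = A (T f)) ->
  (forall u : nat -> V, (forall k, C (u k) /\ dot (u k) (u k) <= 1) ->
    exists2 h, C h & forall e N, 0 < e -> exists2 k, (N <= k)%N &
      dot (A (u k) - h) (A (u k) - h) <= e) ->
  C g -> c * dot (A g) (A g) < dot (T (A g)) (A g) ->
  exists l f, [/\ c < l, C f, 0 < dot f f & T f = l *: f].
Proof.
move=> lT lA symT symA TA cptA Cg gc.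
have [CT TD _] := lT; have [CA AD _] := lA; have [dC dD d0] := pdot.
(* [W] is [(T - c) A], so that [S = W \o A] is [(T - c) A^2] with one factor [A] applied first, to
   which [cptA] applies. *)
pose W f := (- c) *: A f + T (A f).
have lW : linear_bounded C W.
  by apply: linear_bounded_lin => //; exact: (linear_bounded_comp lT lA).
have [CW WD [M M0 WM]] := lW.
pose S := W \o A.
have lS : linear_bounded C S by exact: linear_bounded_comp.
have [CS SD _] := lS.
have dotZl a f h : C f -> C h -> dot (a *: f) h = a * dot f h.
  exact: psdZ.
have dotS f h : C f -> C h -> dot (S f) h = dot (T (A f)) (A h) - c * dot (A f) (A h).
  move=> Cf Ch; have CAf := CA _ Cf; have CAAf := CA _ CAf.
  rewrite /S /W /= dD//; [|exact: CT].
  by rewrite (symA (A f))// TA// (symA (T (A f)))//; [ring|exact: CT].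
have symS : symmetric_on C S.
  move=> f h Cf Ch; rewrite [RHS]dC//; [|exact: CS].
  rewrite !dotS// (dC (A h)); [|exact: CA..].
  by rewrite (dC (T (A h))) ?symT//; [apply: CA|apply: CA|apply: CT; exact: CA|apply: CA].
(* If [g] had norm 0, so would [A g], and both sides of the strict hypothesis on [g] would
   vanish. *)
have g0 : 0 < dot g g.
  rewrite lt_def d0// andbT; apply/eqP => g0.
  have [_ _ [N _ /(_ _ Cg)]] := lA; rewrite g0 mulr0 => Ag0.
  have CAg := CA _ Cg; have {}Ag0 : dot (A g) (A g) = 0.
    by apply/eqP; rewrite eq_le Ag0 d0.
  have := psd_CS sC pdot (CT _ CAg) CAg; rewrite Ag0 mulr0 => TAg.
  move: gc; rewrite Ag0 mulr0 => TAg0.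
  by have := exprn_gt0 2 TAg0; rewrite ltNge TAg.
have WA f : C f -> S f = W (A f) by [].
have [b [Sb bP]] := rayleigh_sup sC (@subset_refl _ C) lS CS symS Cg g0.
have b0 : 0 < b.
  rewrite -(pmulr_lgt0 _ g0); apply: lt_le_trans (Sb _ Cg).
  by rewrite dotS// subr_gt0.
(* Two approximate eigenvalue equations are solved at once. With [S' = S] this yields an eigenvector
   of [S]; with [S' = T] on the eigenspace it yields one shared by [S] and [T]. *)
have cluster (E : set V) S' b' : E `<=` C -> linear_bounded C S' ->
    (forall e, 0 < e -> exists2 f, E f /\ dot f f = 1 &
      dot (S f - b *: f) (S f - b *: f) <= e /\
      dot (S' f - b' *: f) (S' f - b' *: f) <= e) ->
    exists h, [/\ C h, 0 < dot h h, S h = b *: h & S' h = b' *: h].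
  move=> EC lS' H.
  have /choice[u uP] : forall k : nat, exists f, [/\ E f, dot f f = 1,
      dot (S f - b *: f) (S f - b *: f) <= k.+1%:R^-1 &
      dot (S' f - b' *: f) (S' f - b' *: f) <= k.+1%:R^-1].
    move=> k; have k0 : (0 : R) < k.+1%:R^-1 by rewrite invr_gt0.
    by have [f [Ef f1] [fS fS']] := H _ k0; exists f.
  have [|h Ch hP] := cptA u.
    by move=> k; have [/EC Ck u1 _ _] := uP k; split; rewrite ?u1.
  have CWh := CW _ Ch; have Ch' := lsubspaceZ b^-1 sC CWh.
  have near e : 0 < e -> exists f, [/\ E f, dot f f = 1,
      dot (S f - b *: f) (S f - b *: f) <= e,
      dot (S' f - b' *: f) (S' f - b' *: f) <= e &
      dot (f - b^-1 *: W h) (f - b^-1 *: W h) <= e].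
    (* The squared distance to the candidate is at most [(2 * d + 2 * M * d) / b ^+ 2], which equals
       [e]. *)
    move=> e0; pose d := b ^+ 2 * e / (2 * M + 2).
    have N0 : 0 < 2 * M + 2 by lra.
    have d0' : 0 < d by rewrite divr_gt0// mulr_gt0// exprn_gt0.
    have m0 : 0 < Num.min d e by rewrite lt_min d0'.
    have [N _ NP] := near_infty_natSinv_lt (PosNum m0).
    have [k Nk Akh] := hP _ N d0'.
    have := NP k Nk; rewrite /= lt_min => /andP[kd ke].
    have [/[dup] Ek /EC Ck u1 Sk S'k] := uP k; exists (u k); split => //.
    - exact: le_trans Sk (ltW ke).
    - exact: le_trans S'k (ltW ke).
    have CAk := CA _ Ck; have CAh := lsubspaceB sC CAk Ch.
    have bN0 : b != 0 by rewrite gt_eqF.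
    have CSk := CS _ Ck; have Cbk := lsubspaceZ b sC Ck.
    have CSbk := lsubspaceB sC CSk Cbk.
    have CWAh := CW _ CAh.
    rewrite (_ : _ - _ = b^-1 *: (-1 *: (S (u k) - b *: u k) + W (A (u k) - h))).
      have Cx := lsubspaceD sC (lsubspaceZ (-1) sC CSbk) CWAh.
      set x := _ + W _ in Cx *.
      rewrite (dotZl b^-1 x) ?(dC x) ?(dotZl b^-1 x)//; [|exact: lsubspaceZ..].
      rewrite {}/x in Cx *.
      rewrite mulrA -expr2 exprVn mulrC ler_pdivrMr ?exprn_gt0//.
      apply: le_trans (psd_parallelogram sC pdot (lsubspaceZ (-1) sC CSbk) CWAh) _.
      set y := S (u k) - _ in CSbk Sk *; have Cy := lsubspaceZ (-1) sC CSbk.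
      rewrite (dotZl (-1) y)// (dC y)// (dotZl (-1) y)//.
      have := WM _ CAh.
      have h1 := le_trans Sk (ltW kd).
      have h2 : M * dot (A (u k) - h) (A (u k) - h) <= M * d by rewrite ler_wpM2l.
      have h3 : (2 * M + 2) * d = b ^+ 2 * e by rewrite mulrC divfK// gt_eqF.
      by move: h3; rewrite (mulrC e); lra.
    rewrite (linear_boundedB lW CAk Ch) scaleN1r opprB WA// addrA addrNK.
    by rewrite scalerBr scalerA mulVf// scale1r.
  have [Sh0 h0] := cluster_eigenvector (h := b^-1 *: W h) (b := b) lS EC Ch'
    (fun e e0 => let: ex_intro f (And5 a1 a2 a3 a4 a5) := near e e0 in
       ex_intro _ f (And4 a1 a2 a3 a5)).
  have [S'h0 _] := cluster_eigenvector (h := b^-1 *: W h) (b := b') lS' EC Ch'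
    (fun e e0 => let: ex_intro f (And5 a1 a2 a3 a4 a5) := near e e0 in
       ex_intro _ f (And4 a1 a2 a4 a5)).
  exists (b^-1 *: W h); split => //; apply/eqP; rewrite -subr_eq0; apply/eqP.
  - by apply: dot_def => //; apply: lsubspaceB => //; [exact: CS|exact: lsubspaceZ].
  - have [CS' _ _] := lS'.
    by apply: dot_def => //; apply: lsubspaceB => //; [exact: CS'|exact: lsubspaceZ].
have [h1 [Ch1 h1_gt0 Sh1 _]] :
    exists h, [/\ C h, 0 < dot h h, S h = b *: h & S h = b *: h].
  by apply: (cluster C) => // e e0; have [f ? ?] := bP e e0; exists f.
pose E := [set f | C f /\ S f = b *: f].
have EC : E `<=` C by move=> f [].
have sE : lsubspace E.
  split=> [|a f f' [Cf Sf] [Cf' Sf']].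
    have [C0 _] := sC; split=> //.
    by rewrite -[X in S X](scale0r 0) (linear_boundedZ 0 lS C0) !scale0r scaler0.
  split; first by apply: lsubspaceD => //; exact: lsubspaceZ.
  by rewrite SD// Sf Sf' scalerDr !scalerA mulrC.
have ET f : E f -> E (T f).
  move=> [Cf Sf]; split; first exact: CT.
  rewrite -(linear_boundedZ b lT Cf) -Sf /S /W /=.
  have CAf := CA _ Cf; have CAAf := CA _ CAf.
  by rewrite TD//; [rewrite -!TA//; exact: CT|exact: CT].
have symTE : symmetric_on E T by move=> f f' [Cf _] [Cf' _]; exact: symT.
have [t [_ tP]] := rayleigh_sup sE EC lT ET symTE (conj Ch1 Sh1) h1_gt0.
have [h [Ch h_gt0 Sh Th]] :
    exists h, [/\ C h, 0 < dot h h, S h = b *: h & T h = t *: h].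
  apply: (cluster E) => // e e0; have [f [[Cf Sf] f1] fT] := tP e e0.
  (* On the eigenspace the equation for [S] holds exactly, so its error is 0. *)
  exists f; [by []|split => //]; rewrite Sf subrr.
  have [C0 _] := sC; have := psdZ 0 sC pdot C0 C0.
  by rewrite scale0r mul0r => ->; exact: ltW.
exists t, h; split => //.
(* This gives [b * dot h h = (t - c) * dot (A h) (A h)], whose left side is positive. *)
have := dotS _ _ Ch Ch; rewrite Sh dotZl// TA// Th.
have CAh := CA _ Ch.
rewrite (linear_boundedZ t lA Ch) dotZl// -mulrBl => bt.
rewrite -subr_gt0; have : 0 < (t - c) * dot (A h) (A h) by rewrite -bt mulr_gt0.
by move=> /pmulr_lgt0 H; have := d0 _ CAh; nra.
Qed.

End PreHilbert.

(** * The operator of an n-tuple of group elements *)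

Section MeanZero.
Context (R : realType) (K : ptopGroupType) (mu : probability (borel K) R).
Hypothesis cK : compact [set: K].
Hypothesis cmulK : continuous (fun x : K * K => (x.1 * x.2)%g).
Hypothesis haar : is_haar mu.

Local Notation V := (K -> R^o).

(** On continuous functions [L2dot] is definite without passing to classes modulo null functions.
    Eigenvectors in L^2 are brought into this space by convolution. *)
Definition cont0 : set V := [set f | continuous (f : K -> R) /\ \int[mu]_x f x = 0].

Definition L2dot (f g : V) : R := \int[mu]_x (f x * g x).

Definition ltransl (k : K) (f : V) : V := fun x => f (k^-1 * x)%g.

Definition ltransl_sum n (g : 'I_n -> K) (f : V) : V :=
  \sum_(i < n) (ltransl (g i) f + ltransl (g i)^-1%g f).

Definition spectral_gap n (g : 'I_n -> K) := exists2 e : R, 0 < e &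
  forall f, cont0 f ->
    e * L2dot f f <= \sum_(i < n) L2dot (ltransl (g i) f - f) (ltransl (g i) f - f).

Lemma continuousM_fct (f g : K -> R) : continuous f -> continuous g ->
  continuous (fun x => f x * g x).
Proof. by move=> cf cg x; apply: cvgM; [exact: cf|exact: cg]. Qed.

Lemma continuous_lin (f g : K -> R) (a : R) : continuous f -> continuous g ->
  continuous (fun x => a * f x + g x).
Proof.
move=> cf cg x; apply: cvgD; last exact: cg.
by apply: cvgM; [exact: cvg_cst|exact: cf].
Qed.

Lemma Rintegral_lin (f g : K -> R) (a : R) : continuous f -> continuous g ->
  \int[mu]_x (a * f x + g x) = a * \int[mu]_x f x + \int[mu]_x g x.
Proof.
move=> cf cg; have fi := continuous_integrable mu cK cf.
have gi := continuous_integrable mu cK cg.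
by rewrite RintegralD ?RintegralZl//; exact: integrable_scale.
Qed.

Lemma Rintegral_le_continuous (f g : K -> R) : continuous f -> continuous g ->
  (forall x, f x <= g x) -> \int[mu]_x f x <= \int[mu]_x g x.
Proof.
move=> cf cg fg; apply: le_Rintegral => //; exact: continuous_integrable.
Qed.

Lemma Rintegral_cst1 (c : R) : \int[mu]_x c = c.
Proof.
rewrite Rintegral_cst// -[RHS]mulr1; congr (_ * _).
exact: (congr1 fine (probability_setT mu)).
Qed.

Definition contf : set V := [set f | continuous (f : K -> R)].

Lemma lsubspace_contf : lsubspace contf.
Proof.
split; first by move=> x; exact: cvg_cst.
by move=> a f g; exact: continuous_lin.
Qed.

Lemma cont0_contf : cont0 `<=` contf. Proof. by move=> f []. Qed.

Lemma lsubspace_cont0 : lsubspace cont0.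
Proof.
split.
  by apply: conj; [move=> x; exact: cvg_cst|exact: Rintegral_cst1].
move=> a f g [cf f0] [cg g0]; apply: conj; first exact: continuous_lin.
by have := Rintegral_lin a cf cg; rewrite f0 g0 mulr0 addr0.
Qed.

Lemma psd_contf : psd contf L2dot.
Proof.
split.
- by move=> f g _ _; apply: eq_Rintegral => x _; rewrite mulrC.
- move=> a f g h cf cg ch.
  rewrite /L2dot -Rintegral_lin; [|exact: continuousM_fct..].
  by apply: eq_Rintegral => x _; rewrite mulrA -mulrDl.
- by move=> f cf; apply: Rintegral_ge0 => x _; rewrite -expr2 sqr_ge0.
Qed.

Lemma psd_cont0 : psd cont0 L2dot.
Proof. exact: sub_psd psd_contf cont0_contf. Qed.

Lemma L2dot_def f : contf f -> L2dot f f = 0 -> f = 0.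
Proof.
move=> cf f0; apply/funext => x; apply/eqP/negPn/negP => fx0.
have := haar_integral_gt0 (mu := mu) cK cmulK haar (x := x) (continuousM_fct cf cf).
rewrite -/(L2dot f f) f0 ltxx => H; suff : false by [].
by apply: H => [y|]; rewrite -expr2 ?sqr_ge0// exprn_even_gt0.
Qed.

(** Cauchy-Schwarz against the constant 1, whose norm is 1. *)
Lemma L1_le_L2 f : contf f -> (\int[mu]_x `|f x|) ^+ 2 <= L2dot f f.
Proof.
move=> cf.
have cnf : contf (fun x => `|f x| : R^o).
  by move=> x; apply: cvg_norm; exact: cf.
have c1 : contf (fun=> 1 : R^o) by move=> x; exact: cvg_cst.
have := psd_CS lsubspace_contf psd_contf cnf c1.
rewrite {1}/L2dot; under eq_Rintegral do rewrite mulr1.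
move=> /le_trans; apply; rewrite /L2dot.
under [X in _ * X <= _]eq_Rintegral do rewrite mulr1.
rewrite Rintegral_cst1 mulr1.
by under eq_Rintegral do rewrite -expr2 real_normK ?num_real// expr2.
Qed.

Lemma L2dot_ltransl k f h : contf f -> contf h ->
  L2dot (ltransl k f) h = L2dot f (ltransl k^-1%g h).
Proof.
move=> cf ch; rewrite /L2dot -[RHS](haar_integral cmulK haar (k^-1)%g).
  by apply: eq_Rintegral => x _; rewrite /ltransl invgK mulVKg.
apply: continuous_integrable => //; apply: continuousM_fct => //.
exact: continuous_lshift.
Qed.

Lemma ltransl_cont k f : contf f -> contf (ltransl k f).
Proof. by move=> cf; exact: continuous_lshift. Qed.

Lemma ltransl_isom k f : contf f -> L2dot (ltransl k f) (ltransl k f) = L2dot f f.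
Proof.
move=> cf; rewrite L2dot_ltransl//; last exact: ltransl_cont.
by congr L2dot; apply/funext => x; rewrite /ltransl invgK mulKg.
Qed.

Lemma ltransl_cont0 k f : cont0 f -> cont0 (ltransl k f).
Proof.
move=> [cf f0]; apply: conj; first exact: ltransl_cont.
rewrite -[RHS]f0 -(haar_integral cmulK haar (k^-1)%g (f := f))//.
exact: continuous_integrable.
Qed.

Lemma ltransl_linear_bounded k : linear_bounded L2dot cont0 (ltransl k).
Proof.
split; [exact: ltransl_cont0|by []|exists 1 => // f [cf _]].
by rewrite mul1r ltransl_isom.
Qed.

Lemma ltransl_sum_linear_bounded n (g : 'I_n -> K) :
  linear_bounded L2dot cont0 (ltransl_sum g).
Proof.
have sC := lsubspace_cont0; have pC := psd_cont0.
have [C0 _] := sC.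
have lD S1 S2 : linear_bounded L2dot cont0 S1 -> linear_bounded L2dot cont0 S2 ->
    linear_bounded L2dot cont0 (fun f => S1 f + S2 f).
  move=> l1 l2; have := @linear_bounded_lin R _ cont0 L2dot sC pC S1 S2 1 l1 l2.
  by under eq_fun do rewrite scale1r.
rewrite /ltransl_sum; elim: (index_enum _) => [|i s IH].
  under eq_fun do rewrite big_nil.
  split => // [a f h _ _|]; first by rewrite scaler0 addr0.
  exists 0 => // f _; rewrite mul0r /L2dot.
  by under eq_Rintegral do rewrite mul0r; rewrite Rintegral_cst1.
under eq_fun do rewrite big_cons.
by apply: (lD) => //; apply: (lD); exact: ltransl_linear_bounded.
Qed.

Lemma L2dot_suml I (s : seq I) (f : I -> V) h :
  (forall i, contf (f i)) -> contf h ->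
  L2dot (\sum_(i <- s) f i) h = \sum_(i <- s) L2dot (f i) h.
Proof.
move=> cf ch; have [_ dD _] := psd_contf; have [c0 _] := lsubspace_contf.
elim: s => [|i s IH].
  rewrite !big_nil /L2dot; under eq_Rintegral do rewrite mul0r.
  exact: Rintegral_cst1.
have cs : contf (\sum_(j <- s) f j).
  elim: s {IH} => [|j s IH]; first by rewrite big_nil.
  by rewrite big_cons; apply: (lsubspaceD lsubspace_contf).
by rewrite !big_cons -IH -[f i in LHS]scale1r dD// mul1r.
Qed.

Lemma L2dotDl f g h : contf f -> contf g -> contf h ->
  L2dot (f + g) h = L2dot f h + L2dot g h.
Proof.
move=> cf cg ch; have [_ dD _] := psd_contf.
by rewrite -[f in LHS]scale1r dD// mul1r.
Qed.

Lemma ltransl_sum_contf n (g : 'I_n -> K) f i : contf f ->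
  contf (ltransl (g i) f + ltransl (g i)^-1%g f).
Proof.
by move=> cf; apply: (lsubspaceD lsubspace_contf); exact: ltransl_cont.
Qed.

Lemma ltransl_sum_symmetric n (g : 'I_n -> K) :
  symmetric_on L2dot cont0 (ltransl_sum g).
Proof.
move=> f h [cf _] [ch _]; have [dC _ _] := psd_contf.
have cs f' i : contf f' -> contf (ltransl (g i) f' + ltransl (g i)^-1%g f').
  exact: ltransl_sum_contf.
have cS f' : contf f' -> contf (ltransl_sum g f').
  move=> cf'; rewrite /ltransl_sum; elim: (index_enum _) => [|i s IH].
    by rewrite big_nil; have [] := lsubspace_contf.
  by rewrite big_cons; apply: (lsubspaceD lsubspace_contf) => //; exact: cs.
rewrite (dC f)//; [|exact: cS].
rewrite !L2dot_suml => [|i|//|i|//]; [|exact: cs..].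
apply: eq_bigr => i _; rewrite !L2dotDl//; try exact: ltransl_cont.
rewrite [L2dot _ h]L2dot_ltransl// [L2dot (ltransl (g i)^-1%g f) h]L2dot_ltransl//.
rewrite invgK addrC.
by rewrite (dC f (ltransl (g i) h)) ?(dC f (ltransl (g i)^-1%g h))//; exact: ltransl_cont.
Qed.

(** Translations are isometries, and a translation and its inverse, being adjoint, contribute
    equally to the quadratic form. *)
Lemma ltransl_sum_dot n (g : 'I_n -> K) f : contf f ->
  L2dot (ltransl_sum g f) f =
  (2 * n)%:R * L2dot f f -
    \sum_(i < n) L2dot (ltransl (g i) f - f) (ltransl (g i) f - f).
Proof.
move=> cf; have [dC _ _] := psd_contf; have sC := lsubspace_contf.
rewrite L2dot_suml//; last by move=> i; exact: ltransl_sum_contf.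
rewrite [X in _ = X - _](_ : _ = \sum_(i < n) (2 * L2dot f f)); last first.
  by rewrite sumr_const card_ord -[RHS]mulr_natl natrM; ring.
rewrite -sumrB; apply: eq_bigr => i _.
have cg : contf (ltransl (g i) f) by exact: ltransl_cont.
rewrite (_ : ltransl (g i) f - f = -1 *: f + ltransl (g i) f); last first.
  by rewrite scaleN1r addrC.
rewrite (psd_expand (-1) sC psd_contf)// ltransl_isom// L2dotDl//.
  rewrite [X in _ + X]L2dot_ltransl// invgK (dC f (ltransl (g i) f))//; ring.
exact: ltransl_cont.
Qed.

End MeanZero.

(** * Eigenvalues above a value of the Rayleigh quotient *)

Section EigenvalueAbove.
Context (R : realType) (K : ptopGroupType) (mu : probability (borel K) R).
Hypothesis hK : hausdorff_space K.
Hypothesis cK : compact [set: K].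
Hypothesis scK : @second_countable K.
Hypothesis cmulK : continuous (fun x : K * K => (x.1 * x.2)%g).
Hypothesis cinvK : continuous (fun x : K => x^-1%g).
Hypothesis haar : is_haar mu.

Local Notation V := (K -> R^o).
Local Notation intg f := (mu.-integrable [set: borel K] (EFin \o (f : borel K -> R))).
Local Notation cont0 := (cont0 mu).
Local Notation dot := (L2dot mu).
Local Notation contf := (@contf R K).

Lemma rconv_lin (phi f h : K -> R) (a : R) x : continuous phi -> intg f -> intg h ->
  rconv mu phi (fun y => a * f y + h y) x = a * rconv mu phi f x + rconv mu phi h x.
Proof.
move=> cphi fi hi; rewrite /rconv.
have pf := rconv_integrable cK cmulK x cphi fi.
have ph := rconv_integrable cK cmulK x cphi hi.
rewrite -RintegralZl// -RintegralD//; last exact: integrable_scale.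
by apply: eq_Rintegral => y _; ring.
Qed.

Lemma rconv_linear_bounded (phi : K -> R) : continuous phi ->
  linear_bounded dot cont0 (rconv mu phi : V -> V).
Proof.
move=> cphi; have ci f : contf f -> intg f by exact: continuous_integrable.
split.
- move=> f [/ci fi f0]; apply: conj; first exact: rconv_continuous.
  have := rconv_mean cK scK cmulK cinvK haar cphi fi.
  by rewrite f0 mulr0.
- move=> a f h [/ci fi _] [/ci hi _]; apply/funext => x.
  exact: rconv_lin.
have [M M0 phiM] := continuous_bounded cK cphi.
exists (M ^+ 2) => [|f [cf _]]; first exact: sqr_ge0.
have fi := ci f cf; have ca : contf (rconv mu phi f) by exact: rconv_continuous.
apply: (@le_trans _ _ (M ^+ 2 * (\int[mu]_x `|f x|) ^+ 2)); last first.
  by rewrite ler_wpM2l ?sqr_ge0//; exact: L1_le_L2.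
rewrite -exprMn -[leRHS](Rintegral_cst1 mu) /L2dot.
apply: (Rintegral_le_continuous mu cK).
- exact: continuousM_fct.
- by move=> x; exact: cvg_cst.
move=> x; rewrite -expr2 -real_normK ?num_real// lerXn2r ?nnegrE//.
  by apply: mulr_ge0; [exact: ltW|exact: Rintegral_ge0].
exact: rconv_le.
Qed.

Lemma ltransl_sumE n (g : 'I_n -> K) (f : V) x : ltransl_sum g f x =
  \sum_(i < n) (f ((g i)^-1 * x)%g + f ((g i)^-1^-1 * x)%g).
Proof. by rewrite /ltransl_sum fct_sumE. Qed.

Lemma integrable_addf (f h : V) : intg f -> intg h -> intg (f + h).
Proof.
by move=> fi hi; have := integrableD measurableT fi hi; apply: eq_integrable.
Qed.

Lemma ltransl_sum_integrable (u : K -> R) n (g : 'I_n -> K) :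
  intg u -> intg (ltransl_sum g u).
Proof.
move=> ui; rewrite /ltransl_sum; elim: (index_enum _) => [|i s IH].
  by rewrite big_nil; apply: continuous_integrable => // y; exact: cvg_cst.
rewrite big_cons; apply: integrable_addf => //.
by apply: integrable_addf; exact: integrable_mulgl.
Qed.

Lemma rconv_ltransl_sum (phi u : K -> R) n (g : 'I_n -> K) :
  continuous phi -> intg u ->
  rconv mu phi (ltransl_sum g u) = ltransl_sum g (rconv mu phi u).
Proof.
move=> cphi ui; apply/funext => x; rewrite ltransl_sumE.
have ti k : intg (fun y => u (k * y)%g) by exact: integrable_mulgl.
rewrite /ltransl_sum.
(* Integrability of the partial sums is carried through the induction, as additivity of the integral
   requires it. *)
suff [] : intg (\sum_(i <- index_enum 'I_n) (ltransl (g i) u + ltransl (g i)^-1%g u))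
  /\ rconv mu phi (\sum_(i <- index_enum 'I_n) (ltransl (g i) u +
       ltransl (g i)^-1%g u)) x =
     \sum_(i <- index_enum 'I_n) (rconv mu phi u ((g i)^-1 * x)%g +
        rconv mu phi u ((g i)^-1^-1 * x)%g) by [].
elim: (index_enum _) => [|i s [IH1 IH2]].
  rewrite !big_nil; split; first by apply: continuous_integrable => // y; exact: cvg_cst.
  rewrite /rconv; under eq_Rintegral do rewrite mulr0.
  exact: Rintegral_cst1.
rewrite !big_cons.
have rD (f h : V) : intg f -> intg h ->
    rconv mu phi (f + h) x = rconv mu phi f x + rconv mu phi h x.
  move=> fi hi; have := rconv_lin 1 x cphi fi hi.
  by rewrite mul1r => <-; congr rconv; apply/funext => y /=; rewrite mul1r.
have di : intg (ltransl (g i) u + ltransl (g i)^-1%g u).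
  by apply: integrable_addf; exact: ti.
split; first exact: integrable_addf.
rewrite rD// IH2 rD; [|exact: ti..].
by rewrite /ltransl !(rconv_mulgl cK cmulK haar).
Qed.

(** Uniform clustering implies clustering in L^2, and preserves mean 0, since the total mass is
    1. *)
Lemma rconv_compact (phi : K -> R) (u : nat -> V) : continuous phi ->
  (forall k, cont0 (u k) /\ dot (u k) (u k) <= 1) ->
  exists2 h : V, cont0 h & forall e N, 0 < e -> exists2 k, (N <= k)%N &
    dot (rconv mu phi (u k) - h) (rconv mu phi (u k) - h) <= e.
Proof.
move=> cphi uP; have ci f : contf f -> intg f by exact: continuous_integrable.
have cu k : contf (u k) by have [[]] := uP k.
have ui k : intg (u k) by exact: ci.
have u1 k : \int[mu]_x `|u k x| <= 1.
  rewrite -(@ler_pXn2r _ 2) ?nnegrE//; last exact: Rintegral_ge0.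
  by rewrite expr1n; apply: le_trans (L1_le_L2 mu cK (cu k)) _; have [] := uP k.
have [h ch H] := rconv_cluster cK cmulK cinvK cphi ui u1.
have ca k : contf (rconv mu phi (u k)) by exact: rconv_continuous.
have sC := @lsubspace_contf R K.
exists h => [|e N e0].
  apply: conj => //; apply/eqP; rewrite -normr_le0; apply/ler_addgt0Pl => e e0.
  have [k _ Hk] := H e 0%N e0.
  have k0 : \int[mu]_x rconv mu phi (u k) x = 0.
    have [CA _ _] := rconv_linear_bounded cphi.
    by have [/CA[]] := uP k.
  have /= E := Rintegral_lin mu cK (-1) (ca k) ch.
  rewrite k0 mulr0 add0r in E; rewrite -E addr0.
  have cd : contf (fun x => -1 * rconv mu phi (u k) x + h x).
    exact: (continuous_lin (ca k) ch).
  apply: le_trans (le_normr_Rintegral measurableT (ci _ cd)) _.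
  rewrite -[leRHS](Rintegral_cst1 mu); apply: (Rintegral_le_continuous mu cK).
  - by move=> x; apply: cvg_norm; exact: cd.
  - by move=> x; exact: cvg_cst.
  - by move=> x; rewrite mulN1r addrC distrC.
(* A number of absolute value at most 1 and at most [e] has its square at most [e]. *)
have m0 : 0 < Num.min 1 e by rewrite lt_min ltr01.
have [k Nk Hk] := H _ N m0; exists k => //.
rewrite -[leRHS](Rintegral_cst1 mu) /L2dot.
apply: (Rintegral_le_continuous mu cK).
- by apply: continuousM_fct; exact: (lsubspaceB sC).
- by move=> x; exact: cvg_cst.
move=> x; have := Hk x; rewrite le_min => /andP[h1 he].
rewrite -expr2 -real_normK ?num_real// expr2; apply: le_trans he.
by rewrite ler_piMl.
Qed.

(** Convolution by an approximate identity serves as the compact operator; it is chosen so close to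
    the identity at [f] that the strict inequality survives. *)
Lemma eigenvalue_above n (g : 'I_n -> K) c f : cont0 f ->
  c * dot f f < dot (ltransl_sum g f) f ->
  exists l f', [/\ c < l, cont0 f', 0 < dot f' f' & ltransl_sum g f' = l *: f'].
Proof.
move=> Cf cf_lt; have [cf _] := Cf.
have lT := ltransl_sum_linear_bounded cK cmulK haar g.
have [CT _ _] := lT; have [cTf _] := CT _ Cf.
pose q := dot (ltransl_sum g f) f - c * dot f f.
have q0 : 0 < q by rewrite subr_gt0.
have [M M0 fM] := continuous_bounded cK cf.
(* [d * N] bounds the pointwise change of the integrand [T f * f - c * f^2] when [f] is moved by at
   most [d <= 1]; then [d] is taken to make [d * N] smaller than [q]. *)
pose N : R := (2 * n)%:R * (2 * M + 1) + `|c| * (2 * M + 1).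
have N0 : 0 <= N by rewrite addr_ge0// mulr_ge0// addr_ge0// mulr_ge0// ltW.
pose d := Num.min 1 (q / (2 * (N + 1))).
have N1 : 0 < 2 * (N + 1) by rewrite mulr_gt0// ltr_wpDl.
have d0 : 0 < d by rewrite lt_min ltr01 divr_gt0.
have [phi [cphi phiV Hphi]] := rconv_approx hK cK cmulK cinvK haar cf d0.
have lA := rconv_linear_bounded cphi; have [CA _ _] := lA.
have Ch := CA _ Cf; set h := rconv mu phi f in Ch Hphi *.
have [ch _] := Ch; have [cTh _] := CT _ Ch.
apply: (compact_commutant_eigenvector (lsubspace_cont0 mu cK)
  (psd_cont0 mu cK) _ lT lA _ _ _ _ Cf).
- by move=> f' [cf' _]; exact: L2dot_def.
- exact: ltransl_sum_symmetric.
- move=> f1 f2 [cf1 _] [cf2 _]; apply: rconv_sym => //; exact: continuous_integrable.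
- move=> f1 [cf1 _]; rewrite rconv_ltransl_sum//.
  exact: continuous_integrable.
- by move=> u uP; exact: rconv_compact.
rewrite -/h -subr_gt0.
have ThTf x : `|ltransl_sum g h x - ltransl_sum g f x| <= (2 * n)%:R * d.
  rewrite !ltransl_sumE -sumrB; apply: le_trans (ler_norm_sum _ _ _) _.
  rewrite (_ : (2 * n)%:R * d = \sum_(i < n) (2 * d)); last first.
    by rewrite sumr_const card_ord -[RHS]mulr_natl natrM; ring.
  apply: ler_sum => i _; rewrite opprD addrACA.
  by apply: le_trans (ler_normD _ _) _; rewrite mulr_natl mulr2n lerD.
have Tf_le x : `|ltransl_sum g f x| <= (2 * n)%:R * M.
  rewrite !ltransl_sumE; apply: le_trans (ler_norm_sum _ _ _) _.
  rewrite (_ : (2 * n)%:R * M = \sum_(i < n) (2 * M)); last first.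
    by rewrite sumr_const card_ord -[RHS]mulr_natl natrM; ring.
  apply: ler_sum => i _.
  by apply: le_trans (ler_normD _ _) _; rewrite mulr_natl mulr2n lerD.
have point x : - c * (f x * f x) + ltransl_sum g f x * f x <=
    1 * (- c * (h x * h x) + ltransl_sum g h x * h x) + d * N.
  have d1 : d <= 1 by rewrite ge_min lexx.
  set s := ltransl_sum g f x; set t := ltransl_sum g h x.
  have e1 : `|(t - s) * h x| <= (2 * n)%:R * d * (M + 1).
    rewrite normrM ler_pM//; first exact: ThTf.
    have := ler_normD (h x - f x) (f x); rewrite subrK.
    by have := Hphi x; have := fM x; lra.
  have e2 : `|s * (h x - f x)| <= (2 * n)%:R * M * d.
    by rewrite normrM ler_pM//; exact: Tf_le.
  have e3 : `|c * ((h x - f x) * (h x + f x))| <= `|c| * (d * (2 * M + 1)).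
    rewrite !normrM ler_wpM2l// ler_pM//.
    have := ler_normD (h x - f x) (f x + f x); rewrite addrA subrK => H.
    apply: le_trans H _; have := ler_normD (f x) (f x).
    by have := Hphi x; have := fM x; lra.
  (* The change splits as [(t - s) h + s (h - f)] minus [c (h - f) (h + f)]. *)
  move: e1 e2 e3; rewrite !ler_norml => /andP[e1 _] /andP[e2 _] /andP[_ e3].
  rewrite /N; lra.
have cff : continuous (fun x => f x * f x : R).
  exact: (continuousM_fct cf cf).
have chh : continuous (fun x => h x * h x : R).
  exact: (continuousM_fct ch ch).
have cTff : continuous (fun x => ltransl_sum g f x * f x : R).
  exact: (continuousM_fct cTf cf).
have cThh : continuous (fun x => ltransl_sum g h x * h x : R).
  exact: (continuousM_fct cTh ch).
have cR : continuous (fun x => - c * (h x * h x) + ltransl_sum g h x * h x : R).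
  exact: (continuous_lin chh cThh).
have cc : continuous (fun _ : K => (d * N : R)) by move=> x; exact: cvg_cst.
have := Rintegral_le_continuous mu cK
  (continuous_lin cff cTff) (continuous_lin cR cc) point.
rewrite !(Rintegral_lin mu cK)// Rintegral_cst1.
rewrite -/(dot f f) -/(dot h h) -/(dot (ltransl_sum g f) f).
rewrite -/(dot (ltransl_sum g h) h).
have dN : d * (N + 1) <= q / 2.
  rewrite -ler_pdivlMr ?ltr_wpDl// -mulrA -invfM.
  by rewrite /d ge_min lexx orbT.
by rewrite /q in q0 dN *; lra.
Qed.

End EigenvalueAbove.

(** * The supremum of the eigenvalues and the spectral gap *)

(* [filterS] does not find the filter structure of {ae mu, _} when mu is a
   probability on [borel K]; these instances over an abstract type do apply. *)
Lemma ae_imply2 d (T : measurableType d) (R : realType)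
    (mu : {measure set T -> \bar R}) (P Q S : T -> Prop) :
  (forall x, P x -> Q x -> S x) -> {ae mu, forall x, P x} ->
  {ae mu, forall x, Q x} -> {ae mu, forall x, S x}.
Proof. exact: filterS2. Qed.

Lemma ae_imply d (T : measurableType d) (R : realType)
    (mu : {measure set T -> \bar R}) (P Q : T -> Prop) :
  (forall x, P x -> Q x) -> {ae mu, forall x, P x} -> {ae mu, forall x, Q x}.
Proof. exact: filterS. Qed.

Section Lambda1.
Context (R : realType) (K : ptopGroupType) (mu : probability (borel K) R).
Hypothesis hK : hausdorff_space K.
Hypothesis cK : compact [set: K].
Hypothesis scK : @second_countable K.
Hypothesis cmulK : continuous (fun x : K * K => (x.1 * x.2)%g).
Hypothesis cinvK : continuous (fun x : K => x^-1%g).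
Hypothesis haar : is_haar mu.

Local Notation V := (K -> R^o).
Local Notation intg f := (mu.-integrable [set: borel K] (EFin \o (f : borel K -> R))).
Local Notation cont0 := (cont0 mu).
Local Notation dot := (L2dot mu).
Local Notation contf := (@contf R K).

Lemma continuous_Lfun2 (f : K -> R) : continuous f ->
  (f : borel K -> R) \in Lfun mu 2%:E.
Proof.
move=> cf; have mf := continuous_borel_measurable cf.
rewrite inE; apply/andP; split; rewrite inE//= /finite_norm unlock /Lnorm.
rewrite poweR_lty//.
have c2 : continuous (fun x => `|f x| ^+ 2).
  move=> x; apply: (@continuous_comp _ _ _ (fun x => `|f x|) (fun y : R => y ^+ 2)).
    by apply: cvg_norm; exact: cf.
  exact: exprn_continuous.
under eq_integral do rewrite /= powR_mulrn//.
exact: integrable_lty (continuous_integrable mu cK c2).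
Qed.

(** Convolution commutes with the operator, so it turns an integrable eigenvector into a continuous
    one. A kernel not orthogonal to [u] makes the value at 1 nonzero. *)
Lemma continuous_eigenvector (u : K -> R) n (g : 'I_n -> K) l :
  intg u -> \int[mu]_x u x = 0 -> ~ {ae mu, forall x, u x = 0} ->
  {ae mu, forall x, ltransl_sum g u x = l * u x} ->
  exists f, [/\ cont0 f, 0 < dot f f & ltransl_sum g f = l *: f].
Proof.
move=> ui u0 une Tu.
have [phi [cphi phiu]] : exists phi : K -> R,
    continuous phi /\ \int[mu]_x (phi x * u x) <> 0.
  apply/not_existsP => H; apply: une.
  apply: (integrable_annihilator hK cK scK ui) => phi cphi.
  by apply/eqP/negPn/negP => /eqP h; exact: (H phi).
exists (rconv mu phi u).
have cf : contf (rconv mu phi u) by exact: rconv_continuous.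
have [dC dD d0] := psd_contf mu cK.
split.
- apply: conj => //.
  by have := rconv_mean cK scK cmulK cinvK haar cphi ui; rewrite u0 mulr0.
- rewrite lt_def d0// andbT; apply/eqP => /(L2dot_def cK cmulK haar cf) f0.
  apply: phiu; have := congr1 (fun f => f 1%g) f0; rewrite /rconv /=.
  by under eq_Rintegral do rewrite invg1 mul1g.
rewrite -rconv_ltransl_sum//; apply/funext => x.
have -> : (l *: rconv mu phi u) x = l * rconv mu phi u x by [].
rewrite /rconv -RintegralZl//; last exact: rconv_integrable.
have Tui := ltransl_sum_integrable cK cmulK haar g ui.
have cp : continuous (fun y => phi (x^-1 * y)%g) by exact: continuous_lshift.
have /integrableP[m1 _] := continuous_Mintegrable cK cp Tui.
have /integrableP[m2 _] := integrable_scale l (rconv_integrable cK cmulK x cphi ui).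
congr fine; apply: ae_eq_integral => //.
by move: Tu; apply: ae_imply => y /= -> _; congr EFin; ring.
Qed.

Lemma sum_Re (I : Type) (s : seq I) (F : I -> R[i]) :
  complex.Re (\sum_(i <- s) F i) = \sum_(i <- s) complex.Re (F i).
Proof. by apply: (big_morph (@complex.Re R)) => // -[? ?] [? ?]. Qed.

Lemma sum_Im (I : Type) (s : seq I) (F : I -> R[i]) :
  complex.Im (\sum_(i <- s) F i) = \sum_(i <- s) complex.Im (F i).
Proof. by apply: (big_morph (@complex.Im R)) => // -[? ?] [? ?]. Qed.

Context (F : groupType) (n : nat) (a : 'I_n -> F).

Lemma basis_operator_Re (rho : GrpHom F K) (f : K -> R[i]) x :
  complex.Re (basis_operator a rho f x) =
  ltransl_sum (fun i => rho (a i)) (fun y => complex.Re (f y) : R^o) x.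
Proof.
rewrite ltransl_sumE sum_Re; apply: eq_bigr => i _.
by rewrite /ltranslate; case: (f _) => ? ?; case: (f _).
Qed.

Lemma basis_operator_Im (rho : GrpHom F K) (f : K -> R[i]) x :
  complex.Im (basis_operator a rho f x) =
  ltransl_sum (fun i => rho (a i)) (fun y => complex.Im (f y) : R^o) x.
Proof.
rewrite ltransl_sumE sum_Im; apply: eq_bigr => i _.
by rewrite /ltranslate; case: (f _) => ? ?; case: (f _).
Qed.

(** The operator and [l] are real, so the real and imaginary parts satisfy the eigenvalue equation
    separately. One of them is not null, and convolution makes it continuous. *)
Lemma L2_0_eigenvalueP (rho : GrpHom F K) (l : R) :
  L2_0_eigenvalue mu (basis_operator a rho) (Complex l 0) <->
  exists f, [/\ cont0 f, 0 < dot f f &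
    ltransl_sum (fun i => rho (a i)) f = l *: f].
Proof.
split=> [[f [[[rL iL] fO] fne Tf]]|[f [[cf f0] ff0 Tf]]].
  have muT : mu setT \is a fin_num by exact: fin_num_measure.
  have ri : intg (fun x => complex.Re (f x)).
    exact/Lfun1_integrable/Lfun_subset12.
  have ii : intg (fun x => complex.Im (f x)).
    exact/Lfun1_integrable/Lfun_subset12.
  have := fO 1; rewrite /L2_dot => -[r0 i0].
  have {r0} : \int[mu]_x complex.Re (f x) = 0.
    by rewrite -[RHS]r0; apply: eq_Rintegral => x _; rewrite rmorph1 mulr1.
  have {i0} : \int[mu]_x complex.Im (f x) = 0.
    by rewrite -[RHS]i0; apply: eq_Rintegral => x _; rewrite rmorph1 mulr1.
  move=> i0 r0.
  have [rae|rne] := pselect {ae mu, forall x, complex.Re (f x) = 0}; last first.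
    apply: continuous_eigenvector ri r0 rne _.
    move: Tf; apply: ae_imply => x E; rewrite -basis_operator_Re E.
    by case: (f x) => u v /=; rewrite mul0r subr0.
  apply: (continuous_eigenvector ii i0).
    move=> iae; apply: fne; move: rae iae; apply: ae_imply2 => x.
    by case: (f x) => u v /= -> ->.
  move: Tf; apply: ae_imply => x E; rewrite -basis_operator_Im E.
  by case: (f x) => u v /=; rewrite mul0r addr0.
exists (fun x => Complex (f x) 0); split.
- split.
    split; first exact: continuous_Lfun2.
    by apply: continuous_Lfun2 => x; exact: cvg_cst.
  move=> [u v]; rewrite /L2_dot; congr Complex.
  + transitivity ((\int[mu]_x f x) * u); last by rewrite f0 mul0r.
    rewrite -RintegralZr//; last exact: continuous_integrable.
    by apply: eq_Rintegral => x _; rewrite /= mul0r subr0.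
  + transitivity ((\int[mu]_x f x) * - v); last by rewrite f0 mul0r.
    rewrite -RintegralZr//; last exact: continuous_integrable.
    by apply: eq_Rintegral => x _; rewrite /= mul0r addr0.
- move=> fae; move: ff0; rewrite (_ : dot f f = 0) ?ltxx//.
  rewrite -[RHS](Rintegral_cst1 mu); congr fine.
  have cff := continuous_integrable mu cK (continuousM_fct cf cf).
  apply: ae_eq_integral => //; first by case/integrableP : cff.
  by move: fae; apply: ae_imply => x [fx0] _; rewrite fx0 mulr0.
- apply: aeW => x.
  have E1 := basis_operator_Re rho (fun x => Complex (f x) 0) x.
  have E2 := basis_operator_Im rho (fun x => Complex (f x) 0) x.
  apply/eqP; rewrite eq_complex E1 E2 /= !mul0r !mulr0 subr0 addr0.
  apply/andP; split; apply/eqP; first by rewrite Tf.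
  rewrite ltransl_sumE big1// => i _; exact: addr0.
Qed.

Lemma lambda1_lt (rho : GrpHom F K) :
  (lambda1 mu a rho < ((2 * n)%:R)%:E)%E <->
  spectral_gap mu (fun i => rho (a i)).
Proof.
have Tdot := fun f cf => ltransl_sum_dot (mu := mu) cK cmulK haar
  (fun i => rho (a i)) (f := f) cf.
split=> [lam|[e e0 gap]].
  (* [lambda1] is -oo when there is no eigenvalue at all, as for trivial [K]; any [c] below [2n]
     then serves. *)
  have [c lamc c2n] : exists2 c : R, (lambda1 mu a rho <= c%:E)%E & c < (2 * n)%:R.
    case: (lambda1 mu a rho) lam => [r|//|_].
    - by rewrite lte_fin => rn; exists r.
    - by exists ((2 * n)%:R - 1); [exact: leNye|rewrite ltrBlDr ltrDl].
  exists ((2 * n)%:R - c); first by rewrite subr_gt0.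
  move=> f Cf; have [cf _] := Cf; rewrite leNgt; apply/negP => H.
  have H' : c * dot f f < dot (ltransl_sum (fun i => rho (a i)) f) f.
    by rewrite Tdot//; lra.
  have [l [f' [cl Cf' f'0 Tf']]] := eigenvalue_above hK cK scK cmulK cinvK haar Cf H'.
  have : (l%:E <= lambda1 mu a rho)%E.
    apply: ereal_sup_ubound; exists l => //.
    by apply/L2_0_eigenvalueP; exists f'.
  by move=> /le_trans/(_ lamc); rewrite lee_fin leNgt cl.
apply: (@le_lt_trans _ _ ((2 * n)%:R - e)%:E); last by rewrite lte_fin ltrBlDr ltrDl.
apply: ge_ereal_sup => _ [l /L2_0_eigenvalueP[f [Cf f0 Tf]] <-].
rewrite lee_fin; have [cf _] := Cf; have := gap _ Cf; have := Tdot _ cf.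
rewrite Tf (psdZ _ (lsubspace_cont0 mu cK) (psd_cont0 mu cK))//.
by move=> E1 E2; rewrite -(ler_pM2r f0); lra.
Qed.

End Lambda1.

(** * Invariance and measurability of the spectral gap *)

Section FreeBasisInduction.
Context (F : groupType) (S : {pred F}).

(** The closure proof is a parameter of the type so that the group structure can be attached to
    it. *)
Definition subgroup_of (_ : group_closed S) := {x | x \in S}.

Context (closedS : group_closed S).
Local Notation H := (subgroup_of closedS).

HB.instance Definition _ := SubChoice.on H.
HB.instance Definition _ := SubChoice_isSubGroup.Build F (mem S) H closedS.

(** That a basis generates follows from the universal property alone, applied to the subgroup [H]
    and then, for uniqueness, to [F] itself. *)
Lemma free_basis_closed n (a : 'I_n -> F) : is_free_basis a ->
  (forall i, a i \in S) -> forall x, x \in S.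
Proof.
move=> fa aS x.
have [f [fE _]] := fa H (fun i => exist _ (a i) (aS i)).
have vf1 : val (f 1%g) = 1%g by rewrite gmulf1.
have vfM : {morph (fun y => val (f y)) : y z / (y * z)%g}.
  by move=> y z; rewrite gmulfM.
pose vf : GrpHom F F := HB.pack (fun y => val (f y))
  (isUMagmaMorphism.Build F F (fun y => val (f y)) (vf1, vfM)).
(* Both the identity and the inclusion of H composed with f extend a. *)
have [g [_ gU]] := fa F a.
have vfE : g = vf by apply: gU => i; rewrite /= fE.
pose idF : GrpHom F F := HB.pack (@id F)
  (isUMagmaMorphism.Build F F (@id F) (erefl, fun _ _ => erefl)).
have idE : g = idF by apply: gU.
have := congr1 (fun h : GrpHom F F => h x) (etrans (esym idE) vfE).
by move=> /= ->; exact: valP.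
Qed.

End FreeBasisInduction.

Lemma free_basis_ind (F : groupType) n (a : 'I_n -> F) (P : F -> Prop) :
  is_free_basis a -> P 1%g -> (forall x y, P x -> P y -> P (x / y)%g) ->
  (forall i, P (a i)) -> forall x, P x.
Proof.
move=> fa P1 PV Pa x.
have cS : group_closed [pred x | `[< P x >]].
  split; first exact/asboolP.
  by move=> y z /asboolP Py /asboolP Pz; apply/asboolP; exact: PV.
suff : x \in [pred x | `[< P x >]] by move/asboolP.
by apply: (free_basis_closed cS fa) => i; apply/asboolP.
Qed.

(** * Displacements of functions under translation *)

Section GapInvariance.
Context (R : realType) (K : ptopGroupType) (mu : probability (borel K) R).
Hypothesis cK : compact [set: K].
Hypothesis scK : @second_countable K.
Hypothesis cmulK : continuous (fun x : K * K => (x.1 * x.2)%g).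
Hypothesis cinvK : continuous (fun x : K => x^-1%g).
Hypothesis haar : is_haar mu.

Local Notation V := (K -> R^o).
Local Notation cont0 := (cont0 mu).
Local Notation dot := (L2dot mu).
Local Notation contf := (@contf R K).

Definition displacement (k : K) (f : V) := dot (ltransl k f - f) (ltransl k f - f).

Lemma displacement_ge0 k f : contf f -> 0 <= displacement k f.
Proof.
move=> cf; have [_ _] := psd_contf mu cK; apply.
by apply: (lsubspaceB (@lsubspace_contf R K)) => //; exact: ltransl_cont.
Qed.

(** The matrix coefficient of [f] at [k] is the convolution of [f] with itself, which makes the
    displacement continuous in [k]. *)
Lemma displacementE k f : contf f ->
  displacement k f = 2 * dot f f - 2 * rconv mu f f k.
Proof.
move=> cf; have [dC _ _] := psd_contf mu cK.
have ck : contf (ltransl k f) by exact: ltransl_cont.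
rewrite /displacement (_ : _ - f = -1 *: f + ltransl k f); last first.
  by rewrite scaleN1r addrC.
rewrite (psd_expand (-1) (@lsubspace_contf R K) (psd_contf mu cK))//.
rewrite (ltransl_isom cK cmulK haar)// (dC f)//.
have -> : dot (ltransl k f) f = rconv mu f f k by [].
ring.
Qed.

Lemma displacement_continuous f : contf f ->
  continuous (fun k => displacement k f).
Proof.
move=> cf; under eq_fun do rewrite (displacementE _ cf).
have fi := continuous_integrable mu cK cf.
move=> x; apply: cvgB; first exact: cvg_cst.
by apply: cvgM; [exact: cvg_cst|exact: rconv_continuous].
Qed.

Lemma displacement_translate k f g : contf f -> contf g ->
  dot (ltransl k f - ltransl k g) (ltransl k f - ltransl k g) =
  dot (f - g) (f - g).
Proof.
move=> cf cg; rewrite -[RHS](ltransl_isom cK cmulK haar k)//.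
exact: (lsubspaceB (@lsubspace_contf R K)).
Qed.

Lemma displacement1 f : displacement 1%g f = 0.
Proof.
rewrite /displacement (_ : ltransl 1%g f = f).
  by rewrite subrr /L2dot; under eq_Rintegral do rewrite mul0r; exact: Rintegral_cst1.
by apply/funext => x; rewrite /ltransl invg1 mul1g.
Qed.

(** The path from [f] to its translate by [h / k] goes through the translate by [h]; the first leg
    has the length of the displacement by [k], translations being isometries. *)
Lemma displacement_div h k f : contf f ->
  displacement (h / k)%g f <= 2 * displacement h f + 2 * displacement k f.
Proof.
move=> cf; have sC := @lsubspace_contf R K; have pC := psd_contf mu cK.
have ch : contf (ltransl h f) by exact: ltransl_cont.
have ck : contf (ltransl k f) by exact: ltransl_cont.
have chk : contf (ltransl (h / k)%g f) by exact: ltransl_cont.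
have ckV : contf (ltransl k^-1%g f) by exact: ltransl_cont.
have kE : ltransl (h / k)%g f = ltransl h (ltransl k^-1%g f).
  by apply/funext => x; rewrite /ltransl invgK invgM invgK mulgA.
have kK : ltransl k (ltransl k^-1%g f) = f.
  by apply/funext => x; rewrite /ltransl invgK mulVKg.
have E1 : dot (ltransl (h / k)%g f - ltransl h f)
    (ltransl (h / k)%g f - ltransl h f) = displacement k f.
  rewrite kE displacement_translate// -(displacement_translate k)// kK /displacement.
  have cd : contf (ltransl k f - f) by exact: (lsubspaceB sC).
  have cd' := lsubspaceZ (-1) sC cd; have [dC _ _] := pC.
  rewrite -[f - _]opprB -scaleN1r (psdZ (-1) sC pC cd cd') (dC _ _ cd cd').
  by rewrite (psdZ (-1) sC pC cd cd) mulrA mulrNN !mul1r.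
have c1 : contf (ltransl (h / k)%g f - ltransl h f) by exact: (lsubspaceB sC).
have c2 : contf (ltransl h f - f) by exact: (lsubspaceB sC).
have := psd_parallelogram sC pC c1 c2.
by rewrite addrA subrK E1 [leRHS]addrC.
Qed.

Section Words.
Context (F : groupType) (n : nat) (a : 'I_n -> F).
Hypothesis fa : is_free_basis a.

Lemma displacement_word (rho : GrpHom F K) w : exists2 C, 0 <= C &
  forall f, contf f ->
    displacement (rho w) f <= C * \sum_(i < n) displacement (rho (a i)) f.
Proof.
have S0 f : contf f -> 0 <= \sum_(i < n) displacement (rho (a i)) f.
  by move=> cf; apply: sumr_ge0 => i _; exact: displacement_ge0.
move: w; apply: (free_basis_ind fa).
- exists 0 => // f _; by rewrite gmulf1 displacement1 mul0r.
- move=> x y [C C0 HC] [D D0 HD]; exists (2 * C + 2 * D).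
    by rewrite addr_ge0// mulr_ge0.
  move=> f cf; rewrite gmulfF; apply: le_trans (displacement_div _ _ cf) _.
  by have := HC _ cf; have := HD _ cf; lra.
- move=> i; exists 1 => // f cf; rewrite mul1r (bigD1 i)//= lerDl.
  by apply: sumr_ge0 => j _; exact: displacement_ge0.
Qed.

Lemma spectral_gap_words (rho sigma : GrpHom F K) :
  (forall i, exists w, rho (a i) = sigma w) ->
  spectral_gap mu (fun i => rho (a i)) -> spectral_gap mu (fun i => sigma (a i)).
Proof.
move=> /choice[w wE] [e e0 gap].
have /choice[C CP] : forall i, exists C, 0 <= C /\ forall f, contf f ->
    displacement (rho (a i)) f <= C * \sum_(j < n) displacement (sigma (a j)) f.
  by move=> i; have [C C0 HC] := displacement_word sigma (w i);
    exists C; split => //; rewrite wE.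
have S0 : 0 <= \sum_(i < n) C i by apply: sumr_ge0 => i _; have [] := CP i.
have S1 : 0 < \sum_(i < n) C i + 1 by rewrite ltr_wpDl.
(* Adding 1 keeps the denominator positive when all the [C i] vanish. *)
exists (e / (\sum_(i < n) C i + 1)); first by rewrite divr_gt0.
move=> f Cf; have [cf _] := Cf.
rewrite mulrAC ler_pdivrMr//; apply: le_trans (gap _ Cf) _.
set D := \sum_(i < n) dot (ltransl (sigma _) _ - _) _.
have D0 : 0 <= D by apply: sumr_ge0 => j _; exact: displacement_ge0.
apply: (@le_trans _ _ (\sum_(i < n) C i * D)).
  by apply: ler_sum => i _; have [_] := CP i; apply.
by rewrite -mulr_suml mulrC ler_wpM2l// lerDl.
Qed.

(** The gap of [rho] is applied to the translate of [f] by [k^-1], and everything is translated back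
    by [k]. *)
Lemma spectral_gap_conj (rho sigma : GrpHom F K) k :
  (forall x, sigma x = (k * rho x * k^-1)%g) ->
  spectral_gap mu (fun i => rho (a i)) -> spectral_gap mu (fun i => sigma (a i)).
Proof.
move=> sE [e e0 gap]; exists e => // f Cf; have [cf _] := Cf.
have Ch : cont0 (ltransl k^-1%g f) by exact: ltransl_cont0.
have ch : contf (ltransl k^-1%g f) by have [] := Ch.
rewrite -(ltransl_isom cK cmulK haar k^-1%g)//; apply: le_trans (gap _ Ch) _.
apply: ler_sum => i _; rewrite -(displacement_translate k)//; last first.
  exact: ltransl_cont.
rewrite le_eqVlt; apply/orP; left; apply/eqP; congr (dot (_ - _) (_ - _));
  apply/funext => x; rewrite /ltransl ?sE ?invgM ?invgK ?mulgA//;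
  by rewrite ?mulgV ?mulVg ?mul1g.
Qed.

(** [W m] is the set of tuples violating the gap with constant [1 / (m + 1)]. It is a union over [f]
    of open conditions, so it is open although there are uncountably many [f]. *)
Lemma measurable_spectral_gap :
  measurable ([set t | spectral_gap mu (fun i => tnth t i)] : set (n.-tuple (borel K))).
Proof.
have [b [ob bP]] := second_countable_seq scK.
pose W m : set (n.-tuple K) := [set t | exists2 f, cont0 f &
  \sum_(i < n) displacement (tnth t i) f < m.+1%:R^-1 * dot f f].
have mW m : measurable (W m : set (n.-tuple (borel K))).
  apply: (measurable_tuple_box ob) => t [f Cf tf]; have [cf _] := Cf.
  set q := _ * dot f f in tf.
  pose S := \sum_(i < n) displacement (tnth t i) f.
  (* The [n] coordinates together use less than the slack [q - S]; dividing by [n + 1] leaves strict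
     room and allows [n = 0]. *)
  pose d := (q - S) / n.+1%:R.
  have d0 : 0 < d by rewrite divr_gt0 ?subr_gt0.
  have /choice[p pP] : forall i : 'I_n, exists j : nat, b j (tnth t i) /\
      forall k, b j k -> displacement k f < displacement (tnth t i) f + d.
    move=> i; have := @displacement_continuous f cf (tnth t i).
    move=> /cvgrPdist_lt/(_ _ d0)/bP[j bj jP]; exists j; split => // k /jP /=.
    by rewrite ltr_norml => /andP[h _]; lra.
  exists p; split=> [i|s sb]; first by have [] := pP i.
  exists f => //; apply: (@le_lt_trans _ _ (\sum_(i < n)
      (displacement (tnth t i) f + d))).
    by apply: ler_sum => i _; have [_ /(_ _ (sb i))/ltW] := pP i.
  rewrite big_split/= sumr_const card_ord -/S -/q -mulr_natr.
  have : d * n%:R < d * n.+1%:R by rewrite ltr_pM2l// ltr_nat.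
  by rewrite {2}/d divfK//; lra.
rewrite (_ : [set _ | _] = \bigcup_m ~` (W m : set (n.-tuple (borel K)))).
  by apply: bigcupT_measurable => m; exact: measurableC.
apply/seteqP; split=> [t [e e0 gap]|t [m _ nW]].
  have [N _ NP] := near_infty_natSinv_lt (PosNum e0).
  exists N => //= -[f Cf]; have [cf _] := Cf.
  apply/negP; rewrite -leNgt; apply: le_trans (gap _ Cf).
  rewrite ler_wpM2r//; last exact: (ltW (NP N (leqnn N))).
  by have [_ _] := psd_contf mu cK; apply.
exists m.+1%:R^-1; first by rewrite invr_gt0.
by move=> f Cf; rewrite leNgt; apply/negP => H; apply: nW; exists f.
Qed.

End Words.
End GapInvariance.

(** * The zero-one law *)

Local Open Scope quotient_scope.
Local Open Scope ereal_scope.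

Theorem theorem2p4 (R : realType) (K : ptopGroupType)
    (K_lie : is_compact_lie_group R K)
    (mu : probability (borel K) R) (mu_haar : is_haar mu)
    (n : nat) (n_gt2 : (2 < n)%N)
    (F : groupType) (a : 'I_n -> F) (a_basis : is_free_basis a)
    (out_ergodic : is_ergodic (@homQ_measurable K F n a) (homQ_measure mu a)
                     (@out_act F K)) :
  let X := [set rho : GrpHom F K | lambda1 mu a rho < ((2 * n)%:R)%R%:E] in
  hom_measurable a X /\ (hom_measure mu a X = 0 \/ hom_measure mu a X = 1).
Proof.
have [[hK scK cmulK cinvK _] cK] := K_lie.
move=> X.
have XE rho : X rho <-> spectral_gap mu (fun i => rho (a i)) by exact: lambda1_lt.
have Xconj (rho sigma : GrpHom F K) (k : K) :
    (forall x, sigma x = (k * rho x * k^-1)%g) -> X rho -> X sigma.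
  by move=> sE /XE Xr; apply/XE; apply: spectral_gap_conj sE Xr.
have mX : hom_measurable a X.
  rewrite /hom_measurable /= (_ : hom_eval a @` X =
      [set t | spectral_gap mu (fun i => tnth t i)]).
    exact: measurable_spectral_gap.
  apply/seteqP; split=> [_ [rho /XE Xr <-]|t gt].
    by rewrite /=; under eq_fun do rewrite tnth_mktuple.
  (* Freeness makes every tuple the evaluation of a homomorphism. *)
  have [rho [rhoE _]] := a_basis K (fun i => tnth t i).
  exists rho; last by apply: eq_from_tnth => i; rewrite tnth_mktuple rhoE.
  by apply/XE; under eq_fun do rewrite rhoE.
split => //.
(* Conjugation invariance makes the choice of representative immaterial, so [B] pulls back to
   [X]. *)
pose B : set (GrpHomQ F K) := [set c | X (repr c)].
have BX : \pi_(GrpHomQ F K) @^-1` B = X.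
  apply/seteqP; split=> rho; rewrite /B /=;
    have /eqmodP/asboolP[k kE] :
      repr (\pi_(GrpHomQ F K) rho) = rho %[mod GrpHomQ F K] by rewrite reprK.
  - exact: Xconj kE.
  - apply: (Xconj _ _ k^-1%g) => x; rewrite kE invgK !mulgA mulVg mul1g.
    by rewrite mulgVK.
have BE rho : B (\pi_(GrpHomQ F K) rho) = X rho := congr1 (fun S => S rho) BX.
have Xaut (phi : GrpAut F) (rho : GrpHom F K) : X (hom_comp rho phi) = X rho.
  have [psi phiK psiK] := aut_bij phi.
  (* Each [rho (phi (a i))] is a value of [rho], and each [rho (a i)] is the value of
     [hom_comp rho phi] at [psi (a i)]; so the gap passes both ways. *)
  apply/propext; rewrite !XE; split;
    apply: (spectral_gap_words cK cmulK mu_haar a_basis) => i.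
    by exists (aut_hom phi (a i)).
  by exists (psi (a i)); rewrite /= psiK.
have := out_ergodic B; rewrite /homQ_measurable /homQ_measure /= BX; apply => // o.
apply/funext => c; rewrite -(reprK o) -(reprK c) /preimage /mkset.
by rewrite out_actE !BE Xaut.
Qed.
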